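(* Let $n\ge 3$ and let $\mathbf{a}=(a_1,\dots,a_r)$ be a sequence of positive integers with $\sum_{i=1}^r a_i=n$. Let $M_{\mathbf{a}}\subset K[x_1,\dots,x_n,y_1,\dots,y_n,z_1,\dots,z_n]$ be the matching field ideal of $\mathbf{a}$, and let $G_{\mathbf{a}}$ be the associated $3$-hypergraph. Then the polyhedral complex $X_{G_{\mathbf{a}}}$ supports a minimal cellular resolution of the ideal $M_{\mathbf{a}}$.
   Context: $K$ is a field. Put $\alpha_0=0$, $\alpha_t=\sum_{i=1}^t a_i$, and $I_t=\{\alpha_{t-1}+1,\dots,\alpha_t\}$ for $1\le t\le r$. Matching field ideal: for every $3$-subset $\{i<j<k\}$ of $[n]$ let $s$ be the minimal $t$ such that $I_t\cap\{i,j,k\}\ne\emptyset$, and set $m_{\{ijk\}}=x_jy_iz_k$ if $|\{i,j,k\}\cap I_s|=1$ and $m_{\{ijk\}}=x_iy_jz_k$ otherwise. $M_{\mathbf{a}}$ is the ideal generated by all $m_{\{ijk\}}$. Block ordering: write $(i,j,k)$ for $x_iy_jz_k$. For generators $(i,j,k),(\ell,u,v)$ of $M_{\mathbf{a}}$ with $j\in I_s$, $u\in I_t$, one has $(i,j,k)\prec_{\mathbf{a}}(\ell,u,v)$ iff $k>v$; or $k=v$ and $s<t$; or $k=v$, $s=t$, $j>u$; or $k=v$, $s=t$, $j=u$, $i<\ell$. Hypergraph $H_{\mathbf{a}}$: the $3$-uniform hypergraph on $\{x_1,\dots,x_n,y_1,\dots,y_n,z_1,\dots,z_n\}$ whose edges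 are the sets $\{x_i,y_j,z_k\}$ with $x_iy_jz_k$ a generator $m_I$ of $M_{\mathbf{a}}$. Its layers are $z_k\text{-layer}(H_{\mathbf{a}})=\{x_iy_j: x_iy_jz_k\in E(H_{\mathbf{a}})\}$ and $z_ky_l\text{-layer}(H_{\mathbf{a}})=\{x_i: x_iy_lz_k\in E(H_{\mathbf{a}})\}$. Hypergraph $G_{\mathbf{a}}$: let $z_{c_1},\dots,z_{c_m}$ with $c_1<\dots<c_m$ be the $z$-variables occurring in edges of $H_{\mathbf{a}}$ (so $c_m=n$). Let $y_{m_1},\dots,y_{m_k}$ be the distinct $y$-variables occurring in $z_{c_m}\text{-layer}(H_{\mathbf{a}})$, listed in the order in which they appear with respect to $\prec_{\mathbf{a}}$ (earlier block $I_t$ first; within a block, larger index first). Let $x_{k_1},\dots,x_{k_l}$ with $k_1<\dots<k_l$ be the elements of $z_{c_m}y_{m_1}\text{-layer}(H_{\mathbf{a}})$. Define $f$ from the set of these variables to $[m+k+l]$ by $f(z_{c_i})=m-i+1$ for $1\le i\le m$, $f(y_{m_i})=m+i$ for $1\le i\le k$, and $f(x_{k_i})=m+k+i$ for $1\le i\le l$. All variables occurring in edges of $H_{\mathbf{a}}$ lie in the domain of $f$. $G_{\mathbf{a}}$ is the $3$-hypergraph on $[m+k+l]$ with edges $\{f(z_p),f(y_q),f(x_t)\}$ for all $x_ty_qz_p\in E(H_{\mathbf{a}})$. Complex $X_G$: for a $d$-uniform hypergraph $G$ with finite vertex set $V\subset\mathbb{Z}$, the polyhedral complex $X_G$ has as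 its cells the products of simplices $\Delta_{\sigma_1}\times\cdots\times\Delta_{\sigma_d}$, one for each $d$-tuple $(\sigma_1,\dots,\sigma_d)$ of nonempty subsets of $V$ such that for every choice of $v_i\in\sigma_i$ one has $v_1<\dots<v_d$ and $\{v_1,\dots,v_d\}\in E(G)$; here $\Delta_\sigma$ is the simplex with vertex set $\sigma$. The faces of such a cell are the cells with each $\sigma_i$ replaced by a nonempty subset. The vertices of $X_G$ correspond to the edges of $G$. The vertices of $X_{G_{\mathbf{a}}}$ are labelled by the generators of $M_{\mathbf{a}}$ through the bijection $E(H_{\mathbf{a}})\to E(G_{\mathbf{a}})$ induced by $f$, and each cell is labelled by the least common multiple of the labels of its vertices. A labelled polyhedral complex supports a minimal cellular resolution of a monomial ideal $M$ if its vertex labels are the minimal generators of $M$ and the associated cellular complex (the cellular chain complex homogenized by the monomial labels) is a minimal free resolution of $M$. *)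

(* Defs.v *)
From mathcomp Require Import all_boot all_order all_algebra.
From mathcomp.multinomials Require Import mpoly.
Set Implicit Arguments.
Unset Strict Implicit.
Unset Printing Implicit Defensive.
Import Order.TTheory GRing.Theory.
Local Open Scope ring_scope.

Section Resolutions.
Variables (K : fieldType) (N : nat).
Local Notation S := {mpoly K[N]}.

Definition monomial_ideal (P : 'X_{1..N} -> Prop) (p : S) : Prop :=
  exists s : seq (S * 'X_{1..N}),
    (forall cm, cm \in s -> P cm.2) /\ p = \sum_(cm <- s) cm.1 * 'X_[cm.2].

Definition minimal_generator (M : S -> Prop) (m : 'X_{1..N}) : Prop :=
  M 'X_[m] /\ forall m', (m' <= m)%MM -> M 'X_[m'] -> m' = m.

(* A sequence ... -> S^(b 1) -> S^(b 0) -> S of free modules, elements being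
   row vectors, on which [d] and [e] act by right multiplication. *)
Definition free_resolution (b : nat -> nat)
    (d : forall i, 'M[S]_(b i.+1, b i)) (e : 'cV[S]_(b 0)) (M : S -> Prop) :=
  [/\ forall p : S, M p <-> exists u : 'rV_(b 0), (u *m e) 0 0 = p,
      forall u : 'rV_(b 0), u *m e = 0 <-> exists w, u = w *m d 0
    & forall i (u : 'rV_(b i.+1)),
        u *m d i = 0 <-> exists w, u = w *m d i.+1].

(* All entries lie in the ideal generated by the variables. *)
Definition minimal_differentials (b : nat -> nat)
    (d : forall i, 'M[S]_(b i.+1, b i)) :=
  forall i s t, (d i s t)@_0%MM = 0.

End Resolutions.

(* The combinatorial data of a finite polyhedral complex with oriented cells:
   [cinc s t] is the coefficient of [t] in the cellular boundary of [s]. *)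
Record polyhedral_complex := PolyhedralComplex {
  cell :> finType;
  cface : rel cell; (* [cface t s]: [t] is a face of [s] *)
  cdim : cell -> nat;
  cinc : cell -> cell -> int
}.

Section CellularResolution.
Variables (K : fieldType) (N : nat) (X : polyhedral_complex).
Local Notation S := {mpoly K[N]}.
(* Only the values at the vertices are used. *)
Variable vlab : X -> 'X_{1..N}.

Definition clab (s : X) : 'X_{1..N} :=
  \big[@mlcm N/0%MM]_(v : X | (cdim v == 0%N) && cface v s) vlab v.

Definition cells (i : nat) : {set X} := [set s : X | cdim s == i].

(* The augmented cellular chain complex homogenized by the labels: the
   boundary of [s] is the sum of the [cinc s t * X^(clab s - clab t) * t]. *)
Definition cell_diff (i : nat) : 'M[S]_(#|cells i.+1|, #|cells i|) :=
  \matrix_(p, q) let s := enum_val p in let t := enum_val q in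
    (cinc s t)%:~R * 'X_[(clab s - clab t)%MM].

Definition cell_aug : 'cV[S]_#|cells 0| :=
  \col_p 'X_[clab (enum_val p)].

Definition supports_minimal_cellular_resolution (M : S -> Prop) : Prop :=
  [/\ {in cells 0 &, injective vlab},
      forall m, minimal_generator M m <-> exists2 v, v \in cells 0 & vlab v = m,
      free_resolution cell_diff cell_aug M
    & minimal_differentials cell_diff].

End CellularResolution.

Section HypergraphComplex.
Variables (disp : Order.disp_t) (V : finOrderType disp) (d : nat).
Variable E : {set {set V}}.
Local Notation simplices := {ffun 'I_d -> {set V}}.

Definition is_cell (c : simplices) : bool :=
  [forall i, c i != set0] &&
  [forall v : {ffun 'I_d -> V}, [forall i, v i \in c i] ==>
     [forall i : 'I_d, forall j : 'I_d, (i < j)%N ==> (v i < v j)%O]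
     && ([set v i | i : 'I_d] \in E)].

Definition XG_cell : finType := {c : simplices | is_cell c}.

Definition XG_face (t s : XG_cell) : bool :=
  [forall i, val t i \subset val s i].

Definition XG_dim (s : XG_cell) : nat := (\sum_(i < d) #|val s i|.-1)%N.

(* The boundary of a product of ordered simplices: deleting [v] from the
   [i]-th factor contributes with the sign of the rank of [v] in that factor,
   twisted by the dimensions of the preceding factors. *)
Definition XG_inc (s t : XG_cell) : int :=
  \sum_(i < d) \sum_(v in val s i |
      val t == [ffun j => if j == i then val s i :\ v else val s j])
    (-1) ^+ (\sum_(j < d | (j < i)%N) #|val s j|.-1
             + #|[set u in val s i | (u < v)%O]|)%N.

Definition XG : polyhedral_complex :=
  @PolyhedralComplex XG_cell XG_face XG_dim XG_inc.

Definition XG_support (s : XG_cell) : {set V} := \bigcup_(i < d) val s i.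

End HypergraphComplex.

(* All indices are shifted by one: the variables are [x_0, ..., x_(n-1)] and
   so on, and [block t] is the block [I_(t+1)]. *)
Section MatchingField.
Variables (n : nat) (a : seq nat).

Definition alpha (t : nat) : nat := (\sum_(i < t) nth 0 a i)%N.

Definition block (t : nat) : {set 'I_n} :=
  [set i : 'I_n | (alpha t <= i < alpha t.+1)%N].

(* The minimal [t] such that [block t] meets [A]. *)
Definition first_block (A : {set 'I_n}) : nat :=
  find (fun t => block t :&: A != set0) (iota 0 (size a)).

Definition block_of (j : 'I_n) : nat := first_block [set j].

(* The triple (i, j, k) stands for x_i y_j z_k. *)
Definition triple := ('I_n * 'I_n * 'I_n)%type.

Definition matching (i j k : 'I_n) : triple :=
  if #|[set i; j; k] :&: block (first_block [set i; j; k])| == 1%N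
  then (j, i, k) else (i, j, k).

(* The edges of H_a, equivalently the generators of M_a. *)
Definition Hedges : {set triple} :=
  [set matching w.1.1 w.1.2 w.2 | w : triple & (w.1.1 < w.1.2 < w.2)%N].

Definition block_prec (e e' : triple) : bool :=
  let: (i, j, k) := e in let: (l, u, v) := e' in
  [|| (k > v)%N,
      (k == v) && (block_of j < block_of u)%N,
      [&& k == v, block_of j == block_of u & (j > u)%N]
    | [&& k == v, block_of j == block_of u, j == u & (i < l)%N]].

Definition z_layer (k : nat) : {set 'I_n * 'I_n} :=
  [set e.1 | e in Hedges & e.2 == k :> nat].

Definition zy_layer (k l : nat) : {set 'I_n} :=
  [set p.1 | p in z_layer k & p.2 == l :> nat].

(* The lists of the c_1 < ... < c_m, of the m_1, ..., m_k and of the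
   k_1 < ... < k_l; top_z is c_m. *)
Definition z_list : seq nat :=
  [seq val k | k : 'I_n <- enum 'I_n & z_layer k != set0].

Definition top_z : nat := last 0%N z_list.

(* In a fixed z-layer the edges containing a given y-variable
   are consecutive for the block ordering, so that [undup] keeps the order. *)
Definition y_list : seq nat :=
  undup [seq val e.1.2 | e <- sort (fun e e' => (e == e') || block_prec e e')
                                (enum [set e in Hedges | e.2 == top_z :> nat])].

Definition x_list : seq nat :=
  [seq val i | i : 'I_n <- enum 'I_n & i \in zy_layer top_z (head 0%N y_list)].

(* The map f, with values shifted to start from 0. *)
Definition fz (k : nat) : nat := ((size z_list).-1 - index k z_list)%N.
Definition fy (j : nat) : nat := (size z_list + index j y_list)%N.
Definition fx (i : nat) : nat :=
  (size z_list + size y_list + index i x_list)%N.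

Definition Gsize : nat := (size z_list + size y_list + size x_list)%N.

Definition Gedge (e : triple) : {set 'I_Gsize} :=
  [set v : 'I_Gsize | val v \in [:: fz e.2; fy e.1.2; fx e.1.1]].

Definition Gedges : {set {set 'I_Gsize}} := [set Gedge e | e in Hedges].

(* The variables x, y, z are, in this order, those of K[3n]. *)
Definition mon (e : triple) : 'X_{1..n + n + n} :=
  (U_(lshift n (lshift n e.1.1)) + U_(lshift n (rshift n e.1.2))
   + U_(rshift (n + n) e.2))%MM.

Definition matching_ideal (K : fieldType) : {mpoly K[n + n + n]} -> Prop :=
  monomial_ideal (fun m => exists2 e, e \in Hedges & m = mon e).

Definition X_Ga : polyhedral_complex := XG 3 Gedges.

(* The label of a vertex: the generator of the edge of H_a that corresponds to
   the associated edge of G_a. *)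
Definition X_Ga_label (s : X_Ga) : 'X_{1..n + n + n} :=
  if [pick e in Hedges | Gedge e == XG_support s] is Some e
  then mon e else 0%MM.

End MatchingField.

(* Main.v *)
Require Import Defs.
From mathcomp Require Import all_boot all_order all_algebra.
From mathcomp.multinomials Require Import mpoly.
From mathcomp Require Import zify.

(** Write [prec p q] for the linear order of the indices in which later blocks
come first and each block is listed increasingly. The generators are the
monomials x_p y_q z_k such that p and q are smaller than k and [prec p q]
holds ([HedgesE]). The edges are thus closed under two exchanges: an edge stays
an edge when z_k is replaced by z_k' with k' > k, and when y_q is replaced by
y_q' with q' < k and q before q' for [prec]. All of the proof rests on these
exchanges.

By the criterion of Bayer and Sturmfels ([free_resolution_of_acyclic]), the
homogenized chain complex is a resolution as soon as, for every monomial m, the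
subcomplex X_m of the cells whose label divides m is empty or acyclic: a vector
of polynomials in the kernel splits into multihomogeneous parts, and the part of
multidegree m is a cycle of X_m with coefficients in the field.

A cell of X_G is a box, that is, a product of finite sets all of whose points
are edges of G; its vertices are these points, and so the cells of X_m are the
boxes all of whose points come from generators dividing m ([clab_below]). This
turns acyclicity into a statement on the boxes contained in a set Q of tuples.
If Q is stable under setting the j-th coordinate to v, every box in Q may be
enlarged by v in direction j, and the cone over v retracts the complex onto
the boxes lying in the hyperplane where the j-th coordinate is v ([acyclic_cone]).
For X_m one first sets z to the largest available k, then y to the last available
q for [prec], and then x to any available value; a single point is left
([acyclic_below_tuple]).

The resolution is minimal because no label is shared by a cell and one of its
facets: the variable of the deleted vertex divides the label of the cell and
not that of the facet ([clab_inc_nle]). The generators are minimal since they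
all are squarefree of degree 3. It remains to see that the relabelling f is
injective on the variables occurring in edges, i.e., that all of them occur in
the three lists defining f. The exchanges again show this: any edge may be moved
to the top z, and there every x of an edge precedes the last y, which is the
head of the list of the y ([y_list_head], [mem_x_list]). *)

Set Implicit Arguments.
Unset Strict Implicit.
Unset Printing Implicit Defensive.
Import Order.TTheory GRing.Theory.
Local Open Scope ring_scope.

(** * Labels of the cells *)

Section Labels.
Variables (N : nat) (X : polyhedral_complex) (vlab : X -> 'X_{1..N}).

Lemma clabE s k :
  clab vlab s k = \max_(v : X | (cdim v == 0%N) && cface v s) vlab v k.
Proof.
rewrite /clab; elim/big_rec2: _ => [|v p q _ IH]; first by rewrite mnm0E.
by rewrite /mlcm mnmE IH.
Qed.

Lemma clab_leP s m :
  reflect (forall v : X, cdim v == 0%N -> cface v s -> (vlab v <= m)%MM)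
          (clab vlab s <= m)%MM.
Proof.
apply: (iffP mnm_lepP) => [le_m v v0 vs|le_m k].
  apply/mnm_lepP => k; apply: leq_trans (le_m k).
  by rewrite clabE; apply: leq_bigmax_cond; rewrite v0.
rewrite clabE; apply/bigmax_leqP => v /andP[v0 vs].
exact: (mnm_lepP (le_m v v0 vs)).
Qed.
End Labels.

(** * The acyclicity criterion for cellular resolutions *)

Section AcyclicityCriterion.
Variables (K : fieldType) (N : nat) (X : polyhedral_complex).
Variable vlab : X -> 'X_{1..N}.
Local Notation S := {mpoly K[N]}.
Local Notation lab := (clab vlab).

(** The chains, with coefficients in the field, of the subcomplex of the cells
whose label divides [m]. *)
Definition below (m : 'X_{1..N}) (c : X -> K) : Prop :=
  forall s, c s != 0 -> (lab s <= m)%MM.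

Definition acyclic_below (m : 'X_{1..N}) : Prop :=
  forall c : X -> K, below m c ->
    (forall t, \sum_s c s * (cinc s t)%:~R = 0) ->
    \sum_(s | cdim s == 0%N) c s = 0 ->
  exists2 w : X -> K, below m w & forall t, \sum_s w s * (cinc s t)%:~R = c t.

Hypothesis inc_dim : forall s t : X, cinc s t != 0 -> cdim s = (cdim t).+1.
Hypothesis inc_lab : forall s t : X, cinc s t != 0 -> (lab t <= lab s)%MM.
Hypothesis inc_inc : forall s r : X, \sum_t cinc s t * cinc t r = 0.
Hypothesis inc_aug :
  forall s : X, cdim s = 1%N -> \sum_(t | cdim t == 0%N) cinc s t = 0.
Hypothesis acyclic : forall m, acyclic_below m.

(** The entries of the homogenized boundary, indexed by all cells: working with
functions on cells instead of row vectors avoids fixing the dimension. *)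
Definition hdiff (s t : X) : S :=
  (cinc s t)%:~R * 'X_[(lab s - lab t)%MM].

Lemma hdiff0 s t : cinc s t = 0 -> hdiff s t = 0.
Proof. by rewrite /hdiff => ->; rewrite mul0r. Qed.

Lemma mcoeff_mulX (p : S) (k m : 'X_{1..N}) :
  (p * 'X_[k])@_m = if (k <= m)%MM then p@_(m - k) else 0.
Proof.
case: ifP => km; first by rewrite -{1}(submK km) addmC mcoeffMX.
apply/eqP; rewrite mcoeff_eq0 (perm_mem (msuppMX p k)).
apply/negP => /mapP[m' _ def_m]; move: km.
by rewrite def_m lem_addr.
Qed.

(** The coefficients of the part of multidegree [m] of a polynomial chain, the
generator of the cell [s] having degree [lab s]. *)
Definition mpart (m : 'X_{1..N}) (U : X -> S) (s : X) : K :=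
  if (lab s <= m)%MM then (U s)@_(m - lab s) else 0.

(** The homogenized boundary is multihomogeneous and acts on the part of
multidegree [m] as the cellular boundary. *)
Lemma mcoeff_hdiff (U : X -> S) s t m : (lab t <= m)%MM ->
  (U s * hdiff s t)@_(m - lab t) = mpart m U s * (cinc s t)%:~R.
Proof.
move=> tm; have [inc0|nz_inc] := eqVneq (cinc s t) 0.
  by rewrite hdiff0 // mulr0 mcoeff0 inc0 mulr0.
have ts := inc_lab nz_inc.
rewrite /hdiff mulrCA mulrzl raddfMz /= mcoeff_mulX mulrzr /mpart; congr (_ *~ _).
have -> : (lab s - lab t <= m - lab t)%MM = (lab s <= m)%MM.
  apply/mnm_lepP/mnm_lepP => le_s i.
    by have:= le_s i; rewrite !mnmBE leq_subLR subnKC // (mnm_lepP tm).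
  by rewrite !mnmBE leq_sub2r.
case: ifP => // sm; congr (_ @__); apply/mnmP => i; rewrite !mnmBE.
by rewrite subnBA ?(mnm_lepP ts) // subnK // (mnm_lepP tm).
Qed.

(** At a cell [t] whose label does not divide [m] the equation is void, since the
cells having [t] as a facet have larger labels. *)
Lemma mpart_cycle (U : X -> S) m :
  (forall t, \sum_s U s * hdiff s t = 0) ->
  forall t, \sum_s mpart m U s * (cinc s t)%:~R = 0.
Proof.
move=> cycU t; have [tm|ntm] := boolP (lab t <= m)%MM.
  rewrite -[RHS](mcoeff0 _ (m - lab t)%MM) -(cycU t) raddf_sum /=.
  by apply: eq_bigr => s _; rewrite mcoeff_hdiff.
apply: big1 => s _; have [->|/inc_lab ts] := eqVneq (cinc s t) 0.
  by rewrite mulr0.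
by rewrite /mpart (contraNF (lepm_trans ts) ntm) mul0r.
Qed.

Lemma mpart_aug (U : X -> S) m :
  \sum_(s | cdim s == 0%N) U s * 'X_[lab s] = 0 ->
  \sum_(s | cdim s == 0%N) mpart m U s = 0.
Proof.
move=> augU; rewrite -[RHS](mcoeff0 _ m) -augU raddf_sum /=.
by apply: eq_bigr => s _; rewrite mcoeff_mulX.
Qed.

(** Back from a chain over the field to the multihomogeneous polynomial chain of
degree [m]; this is meaningful on the chains [below m]. *)
Definition hchain (m : 'X_{1..N}) (c : X -> K) (s : X) : S :=
  c s *: 'X_[(m - lab s)%MM].

Lemma hchain_hdiff m (w : X -> K) t : below m w ->
  \sum_s hchain m w s * hdiff s t =
  hchain m (fun t => \sum_s w s * (cinc s t)%:~R) t.
Proof.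
move=> wm; rewrite /hchain scaler_suml; apply: eq_bigr => s _.
have [->|nz_w] := eqVneq (w s) 0; first by rewrite mul0r !scale0r mul0r.
have [inc0|nz_inc] := eqVneq (cinc s t) 0.
  by rewrite hdiff0 // mulr0 inc0 mulr0 scale0r.
have [sm ts] := (wm s nz_w, inc_lab nz_inc).
rewrite /hdiff -scalerAl mulrCA -mpolyXD mulrzl mulrzr -scalerMzl -scalerMzr.
congr (_ *: 'X_[_] *~ _); apply/mnmP => i; rewrite !(mnmDE, mnmBE).
by rewrite addnBA ?(mnm_lepP ts) // subnK // (mnm_lepP sm).
Qed.

(** Only finitely many multidegrees matter: those obtained by adding the label
of a cell to a monomial of its coefficient. *)
Lemma hchain_sum (U : X -> S) :
  exists r : seq 'X_{1..N}, forall t, U t = \sum_(m <- r) hchain m (mpart m U) t.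
Proof.
exists (undup [seq (m' + lab s)%MM | s <- enum X, m' <- msupp (U s)]) => t.
apply/mpolyP => k; rewrite raddf_sum /=.
under eq_bigr => m _.
  rewrite /hchain mcoeffZ mcoeffX.
  have -> : mpart m U t * ((m - lab t)%MM == k)%:R =
     if m == (k + lab t)%MM then (U t)@_k else 0.
    rewrite /mpart; case: ifP => tm.
      have -> : ((m - lab t)%MM == k) = (m == (k + lab t)%MM).
        by rewrite -[in RHS](submK tm) eqm_add2r.
      case: eqP => [->|_]; last by rewrite mulr0.
      by rewrite addmK mulr1.
    case: (m =P (k + lab t)%MM) => [def_m|_]; last by rewrite mul0r.
    by rewrite def_m lem_addl in tm.
  over.
have [in_r|nin_r] := boolP ((k + lab t)%MM \in
    [seq (m' + lab s)%MM | s <- enum X, m' <- msupp (U s)]).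
  rewrite (bigD1_seq (k + lab t)%MM) ?undup_uniq ?mem_undup //= eqxx.
  by rewrite big1 ?addr0 // => m /negPf->.
rewrite big_seq big1 => [|m]; last first.
  by rewrite mem_undup; case: eqP nin_r => // <- /negPf->.
apply/eqP; rewrite mcoeff_eq0; apply: contra nin_r => kU.
by apply/allpairsPdep; exists t, k; rewrite mem_enum.
Qed.

(** Each multihomogeneous part of a cycle is a boundary by acyclicity. Adding the
parts one at a time makes a choice of all the preimages superfluous. *)
Lemma hdiff_exact (U : X -> S) :
  (forall t, \sum_s U s * hdiff s t = 0) ->
  \sum_(s | cdim s == 0%N) U s * 'X_[lab s] = 0 ->
  exists W : X -> S, forall t, U t = \sum_s W s * hdiff s t.
Proof.
move=> cycU augU; have [r defU] := hchain_sum U.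
suff [W defW]: exists W : X -> S, forall t,
    \sum_(m <- r) hchain m (mpart m U) t = \sum_s W s * hdiff s t.
  by exists W => t; rewrite defU defW.
elim: r {defU} => [|m r [W defW]].
  exists (fun=> 0) => t; rewrite big_nil.
  by under eq_bigr do rewrite mul0r; rewrite sumr_const mul0rn.
have [|w wm defw] := @acyclic m _ _ (mpart_cycle m cycU) (mpart_aug m augU).
  by move=> s; rewrite /mpart; case: ifP => //; rewrite eqxx.
exists (fun s => hchain m w s + W s) => t.
rewrite big_cons defW; under [RHS]eq_bigr do rewrite mulrDl.
by rewrite big_split /= hchain_hdiff // /hchain defw.
Qed.

(** The factor X^(lab s - lab r) is common to all the terms, so that the identity
reduces to the one for the cellular boundary. *)
Lemma hdiff_hdiff s r : \sum_t hdiff s t * hdiff t r = 0.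
Proof.
have -> : \sum_t hdiff s t * hdiff t r =
    \sum_t (cinc s t * cinc t r)%:~R * 'X_[(lab s - lab r)%MM].
  apply: eq_bigr => t _; have [s0|/inc_lab ts] := eqVneq (cinc s t) 0.
    by rewrite (hdiff0 s0) ?s0 !mul0r.
  have [r0|/inc_lab rt] := eqVneq (cinc t r) 0.
    by rewrite (hdiff0 r0) r0 !mulr0 mul0r.
  rewrite /hdiff mulrACA -intrM -mpolyXD; congr (_ * 'X_[_]).
  apply/mnmP => i; rewrite !(mnmDE, mnmBE) addnBA ?(mnm_lepP rt) //.
  by rewrite subnK // (mnm_lepP ts).
by rewrite -mulr_suml -raddf_sum /= inc_inc mul0r.
Qed.

Lemma hdiff_aug s : cdim s = 1%N ->
  \sum_(t | cdim t == 0%N) hdiff s t * 'X_[lab t] = 0.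
Proof.
move=> s1; have -> : \sum_(t | cdim t == 0%N) hdiff s t * 'X_[lab t] =
    \sum_(t | cdim t == 0%N) (cinc s t)%:~R * 'X_[lab s].
  apply: eq_bigr => t _; have [s0|/inc_lab ts] := eqVneq (cinc s t) 0.
    by rewrite (hdiff0 s0) ?s0 !mul0r.
  by rewrite /hdiff -mulrA -mpolyXD submK.
by rewrite -mulr_suml -raddf_sum /= inc_aug // mul0r.
Qed.

(** A row vector indexed by the cells of dimension [i], extended by zero to all
cells. *)
Definition row_chain i (u : 'rV[S]_#|cells X i|) (s : X) : S :=
  \sum_(p | enum_val p == s) u 0 p.

Lemma row_chain_sum i (u : 'rV[S]_#|cells X i|) (F : X -> S) :
  \sum_p u 0 p * F (enum_val p) = \sum_s row_chain u s * F s.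
Proof.
rewrite (partition_big (fun p => enum_val p : X) predT) //=.
apply: eq_bigr => s _; rewrite /row_chain mulr_suml.
by apply: eq_bigr => p /eqP->.
Qed.

Lemma row_chain_val i (u : 'rV[S]_#|cells X i|) p :
  row_chain u (enum_val p) = u 0 p.
Proof. by rewrite /row_chain (big_pred1 p) // => q; rewrite (inj_eq enum_val_inj). Qed.

Lemma row_chain0 i (u : 'rV[S]_#|cells X i|) s :
  cdim s != i -> row_chain u s = 0.
Proof.
move=> si; rewrite /row_chain big1 // => p /eqP def_s.
by have:= enum_valP p; rewrite def_s inE (negPf si).
Qed.

Lemma mul_cell_diffE i (u : 'rV[S]_#|cells X i.+1|) q :
  (u *m cell_diff K vlab i) 0 q =
  \sum_s row_chain u s * hdiff s (enum_val q).
Proof. by rewrite -row_chain_sum mxE; apply: eq_bigr => p _; rewrite mxE. Qed.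

Lemma mul_cell_augE (u : 'rV[S]_#|cells X 0|) :
  (u *m cell_aug K vlab) 0 0 =
  \sum_(s | cdim s == 0%N) row_chain u s * 'X_[lab s].
Proof.
have -> : (u *m cell_aug K vlab) 0 0 = \sum_p u 0 p * 'X_[lab (enum_val p)].
  by rewrite mxE; apply: eq_bigr => p _; rewrite mxE.
rewrite (row_chain_sum u (fun s => 'X_[lab s])) [RHS]big_mkcond /=.
by apply: eq_bigr => s _; case: ifPn => // s0; rewrite row_chain0 ?mul0r.
Qed.

Lemma row_exact i (u : 'rV[S]_#|cells X i|) :
  (forall t, \sum_s row_chain u s * hdiff s t = 0) ->
  \sum_(s | cdim s == 0%N) row_chain u s * 'X_[lab s] = 0 ->
  exists w, u = w *m cell_diff K vlab i.
Proof.
move=> cyc_u /(hdiff_exact cyc_u)[W defW].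
exists (\row_p W (enum_val p)); apply/rowP => q.
rewrite -row_chain_val defW mxE.
under [RHS]eq_bigr do rewrite !mxE.
rewrite -(big_enum_val (fun s => W s * hdiff s (enum_val q))) /=.
rewrite [RHS]big_mkcond /=; apply: eq_bigr => s _; case: ifPn => // ns.
have [/hdiff0->|/inc_dim ds] := eqVneq (cinc s (enum_val q)) 0.
  by rewrite mulr0.
by have:= enum_valP q; rewrite inE => /eqP dq; rewrite inE ds dq eqxx in ns.
Qed.

Lemma cell_diff_aug : cell_diff K vlab 0 *m cell_aug K vlab = 0.
Proof.
apply/matrixP => p q; rewrite mxE [RHS]mxE ord1.
have ->: \sum_j cell_diff K vlab 0 p j * cell_aug K vlab j 0 =
   \sum_(t in cells X 0) hdiff (enum_val p) t * 'X_[lab t].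
  rewrite (big_enum_val (fun t => hdiff (enum_val p) t * 'X_[lab t])).
  by apply: eq_bigr => j _; rewrite !mxE.
under eq_bigl => t do rewrite inE.
by apply: hdiff_aug; have:= enum_valP p; rewrite inE => /eqP.
Qed.

Lemma cell_diff_diff i : cell_diff K vlab i.+1 *m cell_diff K vlab i = 0.
Proof.
apply/matrixP => p q; rewrite mxE [RHS]mxE.
rewrite -[RHS](hdiff_hdiff (enum_val p) (enum_val q)).
have ->: \sum_j cell_diff K vlab i.+1 p j * cell_diff K vlab i j q =
   \sum_(t in cells X i.+1) hdiff (enum_val p) t * hdiff t (enum_val q).
  rewrite (big_enum_val (fun t => hdiff (enum_val p) t * hdiff t (enum_val q))).
  by apply: eq_bigr => j _; rewrite !mxE.
rewrite big_mkcond /=; apply: eq_bigr => t _; case: ifPn => // nt.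
have [/hdiff0->|/inc_dim dt] := eqVneq (cinc t (enum_val q)) 0.
  by rewrite mulr0.
by have:= enum_valP q; rewrite inE => /eqP dq; rewrite inE dt dq eqxx in nt.
Qed.

(** Bayer-Sturmfels criterion: exactness in the middle is the acyclicity of the
subcomplexes, and exactness at the ring says that the labels of the vertices
generate the ideal. *)
Theorem free_resolution_of_acyclic (P : 'X_{1..N} -> Prop) :
  (forall m, P m <-> exists2 v, v \in cells X 0 & lab v = m) ->
  free_resolution (cell_diff K vlab) (cell_aug K vlab) (monomial_ideal P).
Proof.
move=> genP; split=> [p|u|i u].
- split=> [[r [rP ->]]|[u <-]].
    elim: r rP => [|cm r IHr] rP.
      by exists 0; rewrite mul0mx mxE big_nil.
    have [|u def_u] := IHr; first by move=> c cr; apply: rP; rewrite inE cr orbT.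
    have /genP[v v0 lab_v] := rP cm (mem_head _ _).
    exists (cm.1 *: delta_mx 0 (enum_rank_in v0 v) + u).
    rewrite mulmxDl [LHS]mxE def_u big_cons; congr (_ + _).
    by rewrite -scalemxAl -rowE !mxE enum_rankK_in // lab_v.
  exists [seq (u 0 k, lab (enum_val k)) | k <- enum 'I_#|cells X 0|].
  split=> [cm /mapP[k _ ->]|].
    by apply/genP; exists (enum_val k); first exact: enum_valP.
  by rewrite big_map big_enum mxE; apply: eq_bigr => k _; rewrite mxE.
- split=> [u0|[w ->]]; last by rewrite -mulmxA cell_diff_aug mulmx0.
  apply: row_exact => [t|]; last by rewrite -mul_cell_augE u0 mxE.
  apply: big1 => s _; have [s0|/(row_chain0 u)->] := eqVneq (cdim s) 0%N.
    rewrite [hdiff s t]hdiff0 ?mulr0 //; apply/eqP.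
    by apply: contra_eqT s0 => /inc_dim->.
  by rewrite mul0r.
- split=> [u0|[w ->]]; last by rewrite -mulmxA cell_diff_diff mulmx0.
  apply: row_exact => [t|]; last first.
    by apply: big1 => s /eqP s0; rewrite row_chain0 ?mul0r // s0.
  have [ti|nti] := boolP (t \in cells X i).
    by rewrite -(enum_rankK_in ti ti) -mul_cell_diffE u0 mxE.
  apply: big1 => s _; have [/hdiff0->|/inc_dim ds] := eqVneq (cinc s t) 0.
    by rewrite mulr0.
  by rewrite row_chain0 ?mul0r // ds eqSS; rewrite inE in nti.
Qed.

End AcyclicityCriterion.

(** * Monomials in a monomial ideal *)

Section MonomialIdeals.
Variables (K : fieldType) (N : nat).

(** If no generator divides [m], no term of a combination of the generators
contains [m], so that its coefficient vanishes. *)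
Lemma mem_monomial_ideal (P : 'X_{1..N} -> Prop) m :
  @monomial_ideal K N P 'X_[m] <-> exists2 m', P m' & (m' <= m)%MM.
Proof.
split=> [[r [rP def_m]]|[m' Pm' le_m]]; last first.
  exists [:: ('X_[m - m'], m')]; split=> [cm|]; first by rewrite inE => /eqP->.
  by rewrite big_seq1 -mpolyXD submK.
have [/hasP[cm cmr le_m]|/hasPn none] := boolP (has (fun cm => (cm.2 <= m)%MM) r).
  by exists cm.2 => //; apply: rP.
have /(congr1 (mcoeff m)) := def_m.
rewrite mcoeffX eqxx raddf_sum /= big_seq big1 => [/eqP|cm /none/negPf nle].
  by rewrite oner_eq0.
by rewrite mcoeff_mulX nle.
Qed.
End MonomialIdeals.

(** * Chains of boxes *)

Section BoxChains.
Variables (disp : Order.disp_t) (V : finOrderType disp) (d : nat).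
Local Notation box := {ffun 'I_d -> {set V}}.
Local Notation point := ('I_d * V)%type.
Implicit Types (s t r : box) (p q : point) (x y : {ffun 'I_d -> V}).
Implicit Types Q : pred {ffun 'I_d -> V}.

Definition on_box s p : bool := p.2 \in s p.1.

(** A box is handled as the set of the pairs (direction, vertex) that lie
[on_box] it; the formula below is the one in the definition of [XG_inc]. *)
Definition del_point s p : box :=
  [ffun j => if j == p.1 then s p.1 :\ p.2 else s j].

Definition add_point s p : box :=
  [ffun j => if j == p.1 then p.2 |: s p.1 else s j].

(** Boxes with an empty factor are not cells, so that a box reduced to one vertex
in direction i has no facet in this direction. *)
Definition proper_box s : bool := [forall i, s i != set0].

Definition sign_expo s p : nat :=
  (\sum_(j < d | (j < p.1)%N) #|s j|.-1 + #|[set u in s p.1 | (u < p.2)%O]|)%N.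

Definition box_sgn s p : int := (-1) ^+ sign_expo s p.

(** The incidence numbers of [XG_inc], extended to all boxes. *)
Definition binc s t : int :=
  \sum_(p | on_box s p && (t == del_point s p)) box_sgn s p.

Definition bdim s : nat := (\sum_i #|s i|.-1)%N.

Lemma eq_on_box s t : (forall p, on_box s p = on_box t p) -> s = t.
Proof. by move=> st; apply/ffunP => i; apply/setP => v; apply: (st (i, v)). Qed.

Lemma on_del_point s p q : on_box (del_point s p) q = (q != p) && on_box s q.
Proof.
rewrite /on_box ffunE; case: p q => [i v] [j u] /=; rewrite xpair_eqE.
by case: (j =P i) => [->|_]; rewrite ?inE.
Qed.

Lemma on_add_point s p q : on_box (add_point s p) q = (q == p) || on_box s q.
Proof.
rewrite /on_box ffunE; case: p q => [i v] [j u] /=; rewrite xpair_eqE.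
by case: (j =P i) => [->|_]; rewrite ?inE.
Qed.

Lemma del_pointK s p : on_box s p -> add_point (del_point s p) p = s.
Proof.
by move=> sp; apply: eq_on_box => q; rewrite on_add_point on_del_point; case: eqP => [->|].
Qed.

Lemma add_pointK s p : ~~ on_box s p -> del_point (add_point s p) p = s.
Proof.
move=> /negPf sp; apply: eq_on_box => q; rewrite on_del_point on_add_point.
by case: eqP => [->|].
Qed.

Lemma add_pointC s p q :
  add_point (add_point s p) q = add_point (add_point s q) p.
Proof. by apply: eq_on_box => r; rewrite !on_add_point orbCA. Qed.

Lemma del_add_pointC s p q :
  p != q -> del_point (add_point s p) q = add_point (del_point s q) p.
Proof.
move=> pq; apply: eq_on_box => r; rewrite on_del_point !on_add_point on_del_point.
by case: (r =P p) => [->|//]; rewrite pq.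
Qed.

Lemma proper_sub s t :
  (forall p, on_box s p -> on_box t p) -> proper_box s -> proper_box t.
Proof.
move=> st /forallP s0; apply/forallP => i; have /set0Pn[v si] := s0 i.
by apply/set0Pn; exists v; apply: (st (i, v)).
Qed.

Lemma proper_add s p : proper_box s -> proper_box (add_point s p).
Proof. by apply: proper_sub => q; rewrite on_add_point => ->; rewrite orbT. Qed.

Lemma proper_del s p : proper_box (del_point s p) -> proper_box s.
Proof. by apply: proper_sub => q; rewrite on_del_point => /andP[]. Qed.

Lemma box_sgnK s p : box_sgn s p * box_sgn s p = 1.
Proof. by rewrite /box_sgn -expr2 sqrr_sign. Qed.

(** Up to the sign (-1)^i in direction i, the sign of the deletion of [p] is
(-1)^r, where r is the number of points of the box before [p] for this order;
this makes the boundary a simplicial one. *)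
Definition lexi p q : bool :=
  (p.1 < q.1)%N || (p.1 == q.1) && (p.2 < q.2)%O.

Lemma lexi_total p q : p != q -> lexi p q || lexi q p.
Proof.
case: p q => [i v] [j u]; rewrite /lexi xpair_eqE /=.
have [->|ij] := eqVneq i j; first by rewrite ltnn /= neq_lt.
by rewrite !orbF -neq_ltn.
Qed.

(** In a direction before that of [q], the size minus one drops by one only
because the factor stays nonempty. *)
Lemma sign_expo_del_lt s p q :
  lexi p q -> on_box s p -> proper_box (del_point s p) ->
  sign_expo s q = (sign_expo (del_point s p) q).+1.
Proof.
case: p q => [i v] [j u] /orP[/= ij|/andP[/= /eqP <-{j} vu]] sp sp0.
  rewrite /sign_expo /=.
  have -> : [set w in del_point s (i, v) j | (w < u)%O] = [set w in s j | (w < u)%O].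
    by apply/setP => w; rewrite !inE ffunE /= -val_eqE /= gtn_eqF.
  rewrite (bigD1 i) //= [in RHS](bigD1 i) //=.
  rewrite [del_point s (i, v) i]ffunE /= eqxx (cardsD1 v (s i)) [v \in _]sp.
  have nz : #|s i :\ v| != 0%N.
    by have /forallP/(_ i) := sp0; rewrite ffunE /= eqxx cards_eq0.
  rewrite (eq_bigr (fun k => #|del_point s (i, v) k|.-1)) => [|k /andP[_ /negPf ki]].
    by rewrite -!addSn prednK ?lt0n.
  by rewrite ffunE ki.
rewrite /sign_expo /= -addnS; congr (_ + _)%N.
  apply: eq_bigr => k ki; rewrite ffunE /= ifN //.
  by apply: contraTneq ki => ->; rewrite ltnn.
rewrite (cardsD1 v) !inE [v \in _]sp vu; congr (_.+1).
by apply: eq_card => w; rewrite !inE ffunE eqxx !inE andbA.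
Qed.

Lemma sign_expo_del_gt s p q :
  lexi p q -> sign_expo (del_point s q) p = sign_expo s p.
Proof.
case: p q => [i v] [j u] /orP[/= ij|/andP[/= /eqP <-{j} vu]]; rewrite /sign_expo /=.
  have ik (k : 'I_d) : (k <= i)%N -> del_point s (j, u) k = s k.
    move=> ki; rewrite ffunE /= ifN //.
    by apply: contraTneq ij => <-; rewrite -leqNgt.
  rewrite ik //; congr (_ + _)%N; apply: eq_bigr => k ki.
  by rewrite ik // ltnW.
congr (_ + _)%N.
  apply: eq_bigr => k ki; rewrite ffunE /= ifN //.
  by apply: contraTneq ki => ->; rewrite ltnn.
apply: eq_card => w; rewrite !inE ffunE eqxx !inE.
by case: eqP => //= ->; rewrite ltNge (ltW vu) andbF.
Qed.

(** Deleting first the point that comes first shifts the rank of the other by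
one, while the other order of deletion shifts nothing. All the identities on
boundaries below follow from this one. *)
Lemma box_sgn_del2 s p q : p != q -> on_box s p -> on_box s q ->
    proper_box (del_point (del_point s p) q) ->
  box_sgn s p * box_sgn (del_point s p) q = - (box_sgn s q * box_sgn (del_point s q) p).
Proof.
wlog pq : p q / lexi p q => [IH npq sp sq pr|].
  have /orP[pq|qp] := lexi_total npq; first exact: IH.
  have pr' : proper_box (del_point (del_point s q) p).
    by apply: proper_sub pr => r; rewrite !on_del_point andbCA.
  by rewrite [in RHS](IH q p) ?opprK // eq_sym.
move=> npq sp sq pr; rewrite /box_sgn.
rewrite (@sign_expo_del_gt s p q) // (@sign_expo_del_lt s p q) ?(proper_del pr) //.
by rewrite exprS mulN1r mulNr opprK mulrC.
Qed.

Lemma box_sgn_add2 t p q : p != q -> ~~ on_box t p -> ~~ on_box t q -> proper_box t ->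
  box_sgn (add_point (add_point t p) q) q * box_sgn (add_point t p) p =
  - (box_sgn (add_point (add_point t p) q) p * box_sgn (add_point t q) q).
Proof.
move=> npq tp tq pr; set s := add_point _ q.
have sq : del_point s q = add_point t p.
  by rewrite add_pointK // on_add_point eq_sym negb_or npq.
have sp : del_point s p = add_point t q.
  by rewrite /s add_pointC add_pointK // on_add_point negb_or npq.
rewrite -sq -sp box_sgn_del2 ?sq ?add_pointK //; first by rewrite eq_sym.
- by rewrite on_add_point eqxx.
- by rewrite !on_add_point eqxx orbT.
Qed.

Section Boundary.
Variable U : zmodType.
Implicit Types c w : box -> U.

Definition boundary c t : U :=
  \sum_(p | ~~ on_box t p) c (add_point t p) *~ box_sgn (add_point t p) p.

Lemma boundary_binc c t : boundary c t = \sum_s c s *~ binc s t.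
Proof.
under [RHS]eq_bigr => s _ do rewrite /binc mulrz_sumr.
rewrite (exchange_big_dep predT) //= [LHS]big_mkcond; apply: eq_bigr => p _.
have [tp|ntp] := boolP (on_box t p).
  rewrite big1 // => s /andP[_ /eqP def_t].
  by rewrite def_t on_del_point eqxx in tp.
rewrite (big_pred1 (add_point t p)) // => s /=; apply/andP/eqP => [[sp /eqP->]|->].
  by rewrite del_pointK.
by rewrite on_add_point eqxx add_pointK.
Qed.

(** The two orders of adding the points of a pair cancel. The terms are paired
by means of an arbitrary order of the points, as dividing by 2 would not be
allowed in characteristic 2. *)
Lemma boundary_boundary w t :
  proper_box t -> boundary (boundary w) t = 0.
Proof.
move=> pr_t; rewrite /boundary.
under eq_bigr => p _ do rewrite mulrz_suml.
rewrite pair_big_dep /=.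
pose rk (p : point) := enum_rank p : nat.
have rk_inj : injective rk by move=> p q /val_inj/enum_rank_inj.
pose G (pq : point * point) := w (add_point (add_point t pq.1) pq.2)
  *~ box_sgn (add_point (add_point t pq.1) pq.2) pq.2 *~ box_sgn (add_point t pq.1) pq.1.
pose sw (pq : point * point) := (pq.2, pq.1).
rewrite (bigID (fun pq => rk pq.1 < rk pq.2)%N) /=.
rewrite [X in _ + X](reindex_inj (can_inj (_ : cancel sw sw))) /=; last by case.
rewrite -[RHS](addrN (\sum_(pq : point * point | [&& ~~ on_box t pq.1,
    ~~ on_box t pq.2 & (rk pq.1 < rk pq.2)%N]) G pq)).
congr (_ + _).
  apply: eq_bigl => [[p q]] /=; rewrite on_add_point negb_or -!andbA; congr (_ && _).
  have [->|//] := eqVneq q p; by rewrite ltnn andbF.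
rewrite -sumrN; apply: eq_big => [[p q]|[p q]] /=; rewrite on_add_point negb_or.
  have [->|] := eqVneq p q; first by rewrite ltnn !andbF.
  move=> npq; rewrite -leqNgt leq_eqVlt (inj_eq rk_inj) (negPf npq) /=.
  by rewrite -!andbA andbCA.
case/andP => /and3P[tq npq tp _].
rewrite /G /= -!mulrzA add_pointC box_sgn_add2 ?[add_point (add_point t q) p]add_pointC //.
by rewrite mulrNz opprK.
Qed.

(** The algebraic cone with apex [p0]: it sends a box to which [p0] can be added
to the enlarged box, with the sign for which [p0]-deletion gives the box back. *)
Definition cone (p0 : point) c s : U :=
  if on_box s p0 && proper_box (del_point s p0)
  then c (del_point s p0) *~ box_sgn s p0 else 0.

(** A cycle is the boundary of its cone, except at the boxes whose factor in the
direction of [p0] is reduced to [p0]. If [p0] is not on [t], only the coface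
[add_point t p0] contributes. Otherwise the sum over the cofaces of [t] is,
up to sign, the sum giving the boundary of [c] at [del_point t p0], with the
term of [t] missing. *)
Lemma boundary_cone p0 c t :
  (forall s, proper_box s -> boundary c s = 0) -> proper_box t ->
  ~~ (on_box t p0 && ~~ proper_box (del_point t p0)) ->
  boundary (cone p0 c) t = c t.
Proof.
move=> cyc_c pr_t; have [tp0|ntp0] := boolP (on_box t p0); last first.
  move=> _; rewrite /boundary (bigD1 p0) //= big1 => [|p /andP[ntp pp0]].
    rewrite addr0 /cone on_add_point eqxx add_pointK // pr_t /= -mulrzA.
    by rewrite box_sgnK mulr1z.
  by rewrite /cone on_add_point eq_sym (negPf pp0) (negPf ntp0) mul0rz.
rewrite negbK /= => pr_t'; set t' := del_point t p0 in pr_t'.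
have ntp0' : ~~ on_box t' p0 by rewrite on_del_point eqxx.
have add_t' : add_point t' p0 = t by rewrite del_pointK.
have -> : boundary (cone p0 c) t =
    - (\sum_(p | ~~ on_box t p) c (add_point t' p) *~ box_sgn (add_point t' p) p)
      *~ box_sgn t p0.
  rewrite -sumrN mulrz_suml; apply: eq_bigr => p ntp.
  have npp0 : p0 != p by apply: contraTneq tp0 => ->.
  have ntp' : ~~ on_box t' p by rewrite on_del_point negb_and ntp orbT.
  have dt : del_point (add_point t p) p0 = add_point t' p by rewrite del_add_pointC // eq_sym.
  rewrite /cone on_add_point tp0 orbT dt proper_add //=.
  rewrite mulNrz -!mulrzA -mulrNz; congr (_ *~ _).
  have := box_sgn_add2 npp0 ntp0' ntp' pr_t'; rewrite add_t' => sgn_eq.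
  have -> : box_sgn (add_point t p) p =
      - (box_sgn (add_point t p) p0 * box_sgn (add_point t' p) p) * box_sgn t p0.
    by rewrite -sgn_eq -mulrA box_sgnK mulr1.
  by rewrite !(mulNr, mulrN, mulrA) box_sgnK mul1r.
have := cyc_c t' pr_t'; rewrite /boundary (bigD1 p0) //= add_t'.
move/eqP; rewrite addr_eq0 => /eqP c_eq.
rewrite [in RHS]/=.
rewrite (eq_bigl (fun p => ~~ on_box t' p && (p != p0))).
  by rewrite -c_eq -mulrzA box_sgnK mulr1z.
move=> p; rewrite on_del_point negb_and negbK.
by case: eqP => [->|] //=; rewrite ?tp0 ?andbF ?andbT.
Qed.

End Boundary.

Lemma bdim_del_point s p : on_box s p -> proper_box (del_point s p) ->
  bdim s = (bdim (del_point s p)).+1.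
Proof.
case: p => i v sp sp0; rewrite /bdim (bigD1 i) //= [in RHS](bigD1 i) //=.
rewrite [del_point s (i, v) i]ffunE /= eqxx (cardsD1 v (s i)) [v \in _]sp.
have nz : #|s i :\ v| != 0%N.
  by have /forallP/(_ i) := sp0; rewrite ffunE /= eqxx cards_eq0.
rewrite (eq_bigr (fun k => #|del_point s (i, v) k|.-1)) => [|k /negPf ki].
  by rewrite -!addSn prednK ?lt0n.
by rewrite ffunE ki.
Qed.

Lemma card_vertex t i : proper_box t -> bdim t = 0%N -> #|t i| = 1%N.
Proof.
move=> /forallP/(_ i); rewrite -cards_eq0 => ti /eqP.
by rewrite sum_nat_eq0 => /forallP/(_ i) /=; case: #|t i| ti => [|[]].
Qed.

Lemma sign_expo_vertex t p :
  proper_box t -> bdim t = 0%N -> on_box t p -> sign_expo t p = 0%N.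
Proof.
case: p => i v pr_t t0 tp; rewrite /sign_expo big1 /= => [|j _]; last first.
  by rewrite card_vertex.
have /eqP/cards1P[u tu] := card_vertex i pr_t t0.
move: tp; rewrite /on_box /= tu inE => /eqP->.
by apply: eq_card0 => w; rewrite !inE; case: eqP => //= ->; rewrite ltxx.
Qed.

(** An edge has two ends, of opposite signs; boxes of other dimensions have no
facet that is a vertex. *)
Lemma vertex_boundary s : proper_box s ->
  \sum_(t | proper_box t && (bdim t == 0%N)) binc s t = 0.
Proof.
move=> pr_s; pose vx t := proper_box t && (bdim t == 0%N).
have -> : \sum_(t | vx t) binc s t =
    \sum_(p | on_box s p && vx (del_point s p)) box_sgn s p.
  rewrite /binc (exchange_big_dep (on_box s)) /=; last by move=> t p _ /andP[].
  rewrite [RHS]big_mkcondr; apply: eq_bigr => p sp; rewrite sp /=.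
  case: ifPn => vxp.
    by rewrite (big_pred1 (del_point s p)) // => t /=; case: eqP => [->|]; rewrite ?andbF ?andbT.
  by apply: big1 => t /andP[] /[swap] /eqP->; rewrite (negPf vxp).
have [[i v] /= /andP[sp /andP[pr_p /eqP p0]]|no_p] :=
    pickP (fun p => on_box s p && vx (del_point s p)); last by rewrite big_pred0.
have sk k : k != i -> #|s k| = 1%N.
  by move=> ki; rewrite -(card_vertex k pr_p p0) ffunE /= (negPf ki).
have /eqP/cards1P[u] := card_vertex i pr_p p0; rewrite ffunE /= eqxx => su.
have uv : u != v by have := set11 u; rewrite -su !inE => /andP[].
have si : s i = [set u; v] by rewrite -(setD1K (sp : v \in s i)) su setUC.
have sq : on_box s (i, u) by rewrite /on_box /= si !inE eqxx.
have pr_q : proper_box (del_point s (i, u)).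
  apply/forallP => k; rewrite ffunE /=; case: (k =P i) => [_|/eqP ki].
    by apply/set0Pn; exists v; rewrite si !inE eq_sym uv eqxx orbT.
  by rewrite -cards_eq0 sk.
have q0 : bdim (del_point s (i, u)) = 0%N.
  by apply: succn_inj; rewrite -bdim_del_point // (bdim_del_point sp pr_p) p0.
rewrite (bigD1 (i, v)) /=; last by rewrite sp /vx pr_p p0.
rewrite (bigD1 (i, u)) /=; last first.
  by rewrite sq /vx pr_q q0 xpair_eqE !eqxx /= uv.
rewrite big1 ?addr0 => [|[k w] /=]; last first.
  case/andP => /andP[/andP[sr /andP[/forallP pr_r _]]].
  have ki: k = i.
    apply/eqP; apply: contraT => nki; have := pr_r k; rewrite ffunE /= eqxx.
    rewrite -cards_eq0; have := cardsD1 w (s k); rewrite [w \in _]sr sk //.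
    by case: #|s k :\ w|.
  rewrite ki !xpair_eqE eqxx /= => wv wu.
  by move: sr; rewrite ki /on_box /= si !inE (negPf wv) (negPf wu).
have sgn_sum p q : lexi p q -> on_box s p -> on_box s q ->
    vx (del_point s p) -> vx (del_point s q) -> p != q -> box_sgn s p + box_sgn s q = 0.
  move=> pq onp onq /andP[prp /eqP dp] /andP[prq /eqP dq] npq.
  rewrite /box_sgn (sign_expo_del_lt pq) // -(sign_expo_del_gt s pq).
  by rewrite !sign_expo_vertex ?on_del_point ?onp ?onq ?npq // eq_sym npq.
have npq : (i, v) != (i, u) by rewrite xpair_eqE eqxx eq_sym.
have [pq|qp] := orP (lexi_total npq); last rewrite addrC.
  by apply: sgn_sum; rewrite // /vx ?pr_p ?p0 ?pr_q ?q0.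
by apply: sgn_sum; rewrite // /vx ?pr_p ?p0 ?pr_q ?q0 // eq_sym.
Qed.

Definition in_box s x : bool := [forall i, x i \in s i].

Definition box_in Q s : bool :=
  proper_box s && [forall x, in_box s x ==> Q x].

Lemma box_inP Q s :
  reflect (proper_box s /\ forall x, in_box s x -> Q x) (box_in Q s).
Proof.
apply: (iffP andP) => -[pr_s sQ]; split=> //.
  by move=> x sx; have /forallP/(_ x)/implyP/(_ sx) := sQ.
by apply/forallP => x; apply/implyP => /sQ.
Qed.

Lemma box_in_sub Q s t : (forall p, on_box t p -> on_box s p) -> proper_box t ->
  box_in Q s -> box_in Q t.
Proof.
move=> ts pr_t /box_inP[_ sQ]; apply/box_inP; split=> // x /forallP tx.
by apply: sQ; apply/forallP => i; exact: (ts (i, x i) (tx i)).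
Qed.

Definition update x j v : {ffun 'I_d -> V} :=
  [ffun i => if i == j then v else x i].

Section Acyclicity.
Variable U : zmodType.
Implicit Types c w : box -> U.

Definition chain_in Q c : Prop :=
  forall s, c s != 0 -> box_in Q s.

(** Reduced acyclicity, for chains of mixed dimension; it holds when no box is
contained in [Q]. *)
Definition acyclic_in Q : Prop :=
  forall c, chain_in Q c ->
    (forall t, proper_box t -> boundary c t = 0) ->
    \sum_(s | proper_box s && (bdim s == 0%N)) c s = 0 ->
  exists2 w, chain_in Q w & forall t, proper_box t -> boundary w t = c t.

Lemma box_in_point Q s : (forall x y, Q x -> Q y -> x = y) -> box_in Q s ->
  exists2 x, Q x & s = [ffun i => [set x i]].
Proof.
move=> Q1 /box_inP[/forallP pr_s sQ].
have pick_s i : {v | v \in s i}.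
  by apply/sigW/set0Pn/pr_s.
pose x : {ffun 'I_d -> V} := [ffun i => sval (pick_s i)].
have sx i : x i \in s i by rewrite ffunE; case: (pick_s i).
have Qx : Q x by apply: sQ; apply/forallP.
exists x => //; apply/ffunP => i; rewrite ffunE; apply/eqP.
rewrite eqEsubset sub1set sx andbT; apply/subsetP => v sv.
suff /(Q1 _ _ Qx) -> : Q (update x i v) by rewrite ffunE eqxx inE.
apply: sQ; apply/forallP => j; rewrite ffunE.
by case: eqP => [->|].
Qed.

Lemma acyclic_point Q : (forall x y, Q x -> Q y -> x = y) -> acyclic_in Q.
Proof.
move=> Q1 c cQ cyc_c aug_c; exists (fun=> 0) => [s|t _]; first by rewrite eqxx.
rewrite /boundary big1 => [|p _]; last by rewrite mul0rz.
have [->//|ct] := eqVneq (c t) 0.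
have [x Qx def_t] := box_in_point Q1 (cQ t ct).
have [pr_t _] := box_inP _ _ (cQ t ct).
rewrite -[LHS]aug_c (bigD1 t) /=; last first.
  rewrite pr_t /= sum_nat_eq0; apply/forallP => i.
  by rewrite def_t ffunE cards1.
rewrite big1 ?addr0 // => s /andP[_ st]; apply/eqP; apply: contraNT st => cs.
have [y Qy ->] := box_in_point Q1 (cQ s cs).
by rewrite def_t (Q1 _ _ Qx Qy).
Qed.

Lemma chain_in_boundary Q w t :
  chain_in Q w -> proper_box t -> boundary w t != 0 -> box_in Q t.
Proof.
move=> wQ pr_t; apply: contraNT => ntQ; rewrite /boundary big1 // => p ntp.
have [->|/wQ] := eqVneq (w (add_point t p)) 0; first by rewrite mul0rz.
move=> wQs; case/negP: ntQ; apply: box_in_sub wQs => // q tq.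
by rewrite on_add_point tq orbT.
Qed.

(** A point of the enlarged box with [j]-th coordinate [v] is obtained by setting
this coordinate to [v] in a point of the given box, which exists because
the latter has a nonempty factor in direction [j]. *)
Lemma chain_in_cone Q j v c : (forall x, Q x -> Q (update x j v)) ->
  chain_in Q c -> chain_in Q (cone (j, v) c).
Proof.
move=> Qv cQ s; rewrite /cone; case: ifP => [/andP[sp pr]|]; last by rewrite eqxx.
have [->|/cQ /box_inP[_ tQ] _] := eqVneq (c (del_point s (j, v))) 0.
  by rewrite mul0rz eqxx.
apply/box_inP; split=> [|x /forallP sx]; first exact: proper_del pr.
have [xv|xv] := eqVneq (x j) v; last first.
  apply: tQ; apply/forallP => i.
  suff: on_box (del_point s (j, v)) (i, x i) by [].
  rewrite on_del_point /on_box /= sx andbT xpair_eqE.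
  by case: eqP => //= ->.
have /forallP/(_ j)/set0Pn[u tu] := pr.
have -> : x = update (update x j u) j v.
  by apply/ffunP => i; rewrite !ffunE; case: eqP => // ->.
apply/Qv/tQ; apply/forallP => i; rewrite ffunE.
case: (i =P j) => [->//|/eqP ij].
suff: on_box (del_point s (j, v)) (i, x i) by [].
by rewrite on_del_point /on_box /= sx andbT xpair_eqE (negPf ij).
Qed.

(** Subtracting from a cycle the boundary of its cone moves it to the hyperplane
where the [j]-th coordinate is [v]. *)
Theorem acyclic_cone Q j v : (forall x, Q x -> Q (update x j v)) ->
  acyclic_in (fun x => Q x && (x j == v)) -> acyclic_in Q.
Proof.
move=> Qv acyc c cQ cyc_c aug_c.
pose w := cone (j, v) c; have wQ : chain_in Q w by exact: chain_in_cone.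
pose c' s := if proper_box s then c s - boundary w s else 0.
have [s|t pr_t||w' w'Q def_w'] := acyc c'.
- rewrite /c'; case: ifPn => [pr_s cws|]; last by rewrite eqxx.
  have sQ : box_in Q s.
    have [cs0|/cQ//] := eqVneq (c s) 0.
    by move: cws; rewrite cs0 sub0r oppr_eq0; apply: chain_in_boundary.
  have /andP[sp npr] : on_box s (j, v) && ~~ proper_box (del_point s (j, v)).
    by apply: contraNT cws => H; rewrite boundary_cone // subrr.
  have [_ sQx] := box_inP _ _ sQ.
  apply/box_inP; split=> // x sx; rewrite sQx //=.
  have /forallP/(_ j) sxj := sx.
  apply: contraNT npr => xjv; apply/forallP => i; rewrite ffunE /=.
  case: (i =P j) => _; last by have /forallP/(_ i) := pr_s.
  by apply/set0Pn; exists (x j); rewrite !inE xjv.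
- have -> : boundary c' t = boundary c t - boundary (boundary w) t.
    rewrite -sumrB; apply: eq_bigr => p _.
    by rewrite /c' proper_add // mulrzBl.
  by rewrite cyc_c // boundary_boundary // subr0.
- rewrite (eq_bigr (fun s => c s - boundary w s)) => [|s /andP[pr_s _]].
    rewrite sumrB aug_c sub0r; apply/eqP; rewrite oppr_eq0; apply/eqP.
    under eq_bigr do rewrite boundary_binc.
    rewrite exchange_big /= big1 // => s _; rewrite -mulrz_sumr.
    have [->|/wQ/box_inP[pr_s _]] := eqVneq (w s) 0; first by rewrite mul0rz.
    by rewrite vertex_boundary // mulr0z.
  by rewrite /c' pr_s.
exists (fun s => w s + w' s) => [s|t pr_t].
  have [ws0|/wQ//] := eqVneq (w s) 0; rewrite ws0 add0r => /w'Q.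
  move=> /box_inP[pr_s sQ]; apply/box_inP; split=> // x /sQ.
  by case/andP.
have -> : boundary (fun s => w s + w' s) t = boundary w t + boundary w' t.
  by rewrite -big_split; apply: eq_bigr => p _; rewrite mulrzDl.
by rewrite def_w' // /c' pr_t addrC subrK.
Qed.

End Acyclicity.
End BoxChains.

(** * The complex of a hypergraph as a complex of boxes *)

Section HypergraphCells.
Variables (disp : Order.disp_t) (V : finOrderType disp) (d : nat).
Variable E : {set {set V}}.
Local Notation X := (XG d E).
Local Notation box := {ffun 'I_d -> {set V}}.

Definition edge_tuple (x : {ffun 'I_d -> V}) : bool :=
  [forall i : 'I_d, forall j : 'I_d, (i < j)%N ==> (x i < x j)%O]
  && ([set x i | i : 'I_d] \in E).

Lemma is_cellE : is_cell E =1 box_in edge_tuple.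
Proof. by []. Qed.

Lemma proper_cell (s : X) : proper_box (val s).
Proof. by have /andP[] := valP s. Qed.

Lemma XG_incE (s t : X) : cinc s t = binc (val s) (val t).
Proof. by rewrite /binc /= /XG_inc pair_big_dep. Qed.

Lemma XG_inc_neq0 (s t : X) : cinc s t != 0 ->
  exists2 p, on_box (val s) p & val t = del_point (val s) p.
Proof.
rewrite XG_incE /binc => nz.
have [p /andP[sp /eqP tp]|no_p] :=
    pickP (fun p => on_box (val s) p && (val t == del_point (val s) p)); first by exists p.
by rewrite big_pred0 ?eqxx in nz.
Qed.

Lemma XG_inc_dim (s t : X) : cinc s t != 0 -> cdim s = (cdim t).+1.
Proof.
case/XG_inc_neq0 => p sp tp; have pr_t := proper_cell t.
have -> : cdim t = bdim (val t) by [].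
by rewrite tp in pr_t *; apply: (bdim_del_point sp pr_t).
Qed.

(** Sums over cells are sums over all boxes of functions vanishing outside the
cells. *)
Lemma sum_cells (U : zmodType) (P : pred box) (F : box -> U) :
  (forall s, P s -> ~~ box_in edge_tuple s -> F s = 0) ->
  \sum_(s : X | P (val s)) F (val s) = \sum_(s | P s) F s.
Proof.
move=> F0; rewrite [RHS](bigID (box_in edge_tuple)) /=.
rewrite [X in _ = _ + X]big1 ?addr0 => [|s /andP[]]; last exact: F0.
rewrite [RHS](reindex_omap (val : X -> box) insub) /=; last first.
  by move=> s /andP[_ sE]; rewrite insubT.
apply: eq_bigl => s; rewrite valK eqxx andbT.
by have := valP s; rewrite /= is_cellE => ->; rewrite andbT.
Qed.

(** This is [boundary_boundary] for the chain reduced to [s]; the boxes between two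
cells are cells. *)
Lemma XG_inc_inc (s r : X) : \sum_(t : X) cinc s t * cinc t r = 0.
Proof.
under eq_bigr do rewrite !XG_incE.
have pr_r := proper_cell r.
pose delta (u : box) : int := (u == val s)%:R.
have binc_delta t : binc (val s) t = boundary delta t.
  rewrite boundary_binc (bigD1 (val s)) //= big1 => [|u /negPf us].
    by rewrite /delta eqxx addr0 intz.
  by rewrite /delta us mul0rz.
rewrite (sum_cells (P := xpredT) (F := fun t => binc (val s) t * binc t (val r))).
  rewrite -[RHS](boundary_boundary delta pr_r) [RHS]boundary_binc.
  by apply: eq_bigr => t _; rewrite mulrzz -binc_delta.
move=> t _ ntE; have [r0|nz_r] := eqVneq (binc t (val r)) 0.
  by rewrite r0 mulr0.
suff -> : binc (val s) t = 0 by rewrite mul0r.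
rewrite /binc big_pred0 // => p; apply: contraNF ntE => /andP[sp /eqP def_t].
have [q tq|no_q] := pickP (fun q => on_box t q && (val r == del_point t q)); last first.
  by rewrite /binc big_pred0 ?eqxx in nz_r.
have /andP[_ /eqP def_r] := tq; rewrite def_r in pr_r.
have sE : box_in edge_tuple (val s) := valP s.
apply: box_in_sub sE; last exact: proper_del pr_r.
by move=> u; rewrite def_t on_del_point => /andP[].
Qed.

Lemma XG_inc_aug (s : X) : \sum_(t : X | cdim t == 0%N) cinc s t = 0.
Proof.
under eq_bigr do rewrite XG_incE.
rewrite -[RHS](vertex_boundary (proper_cell s)).
rewrite -[RHS](sum_cells (F := binc (val s))).
  by apply: eq_bigl => t; rewrite proper_cell.
move=> t /andP[pr_t _] ntE; rewrite /binc big_pred0 // => p.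
apply: contraNF ntE => /andP[sp /eqP def_t].
have sE : box_in edge_tuple (val s) := valP s.
by apply: box_in_sub sE => // u; rewrite def_t on_del_point => /andP[].
Qed.

(** When the cells whose label divides [m] are the boxes in [Q], chains on these
cells and chains of boxes in [Q] are the same up to extension by zero. *)
Lemma XG_acyclic_below (K : fieldType) (N : nat) (vlab : X -> 'X_{1..N}) m
    (Q : pred {ffun 'I_d -> V}) :
  (forall s : X, (clab vlab s <= m)%MM = box_in Q (val s)) ->
  subpred Q edge_tuple -> acyclic_in K Q -> acyclic_below K vlab m.
Proof.
move=> labQ QE acycQ c cm cyc_c aug_c.
have boxQE s : box_in Q s -> box_in edge_tuple s.
  case/box_inP => pr_s sQ; apply/box_inP; split=> // x /sQ; exact: QE.
pose c' (s : box) : K := oapp c 0 (insub s : option X).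
have c'val s : c' (val s) = c s by rewrite /c' valK.
have c'Q : chain_in Q c'.
  move=> s; rewrite /c'; case: insubP => [u _ <- /= /cm|_]; last by rewrite eqxx.
  by rewrite labQ.
have sumw (w : box -> K) (t : X) : chain_in Q w ->
    \sum_(s : X) w (val s) * (cinc s t)%:~R = boundary w (val t).
  move=> wQ; rewrite boundary_binc -(sum_cells (P := xpredT)).
    by apply: eq_bigr => s _; rewrite XG_incE mulrzr.
  move=> s _; have [->|/wQ/boxQE->//] := eqVneq (w s) 0.
  by rewrite mul0rz.
have [t pr_t||w wQ def_w] := acycQ c' c'Q.
- apply/eqP; apply: contraT => nz.
  have tE := boxQE t (chain_in_boundary c'Q pr_t nz).
  case/negP: nz; apply/eqP; rewrite -[RHS](cyc_c (Sub t tE)).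
  rewrite -[t in boundary _ t]/(val (Sub t tE : X)) -sumw //.
  by apply: eq_bigr => s _; rewrite c'val.
- rewrite -[RHS]aug_c -[LHS](sum_cells (F := c')) => [|s _ nsE].
    apply: eq_big => [s|s _]; last exact: c'val.
    by rewrite proper_cell.
  by apply/eqP; apply: contraNT nsE => /c'Q/boxQE.
exists (fun s => w (val s)) => [s /wQ|t]; first by rewrite labQ.
by rewrite sumw // def_w ?proper_cell.
Qed.

End HypergraphCells.

(** * The edges of the matching field hypergraph *)

Section MatchingEdges.
Variables (n : nat) (a : seq nat).
Local Notation H := (Hedges n a).
Local Open Scope nat_scope.
Implicit Types (i j k p q : 'I_n) (e : triple n).

Lemma alphaS t : alpha a t.+1 = alpha a t + nth 0 a t.
Proof. by rewrite /alpha big_ord_recr. Qed.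

Lemma leq_alpha t u : t <= u -> alpha a t <= alpha a u.
Proof.
by move/subnKC <-; elim: (u - t) => [|m IHm]; rewrite ?addn0 // addnS alphaS; lia.
Qed.

Lemma ord_eqE p q : (p == q) = (p == q :> nat).
Proof. by []. Qed.

(** The order with later blocks first, increasing in each block. *)
Definition prec p q : bool :=
  (block_of a q < block_of a p) || (block_of a p == block_of a q) && (p < q).

Lemma prec_total p q : [|| p == q, prec p q | prec q p].
Proof. by rewrite /prec !ord_eqE; lia. Qed.

Lemma prec_trans p q r : prec p q -> prec q r -> prec p r.
Proof. by rewrite /prec; lia. Qed.

Definition preceq p q : bool := (p == q) || prec p q.

Lemma prec_preceq p q r : prec p q -> preceq q r -> prec p r.
Proof. by move=> pq /orP[/eqP<-//|]; apply: prec_trans. Qed.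

Lemma preceq_trans q p r : preceq p q -> preceq q r -> preceq p r.
Proof.
by move=> /orP[/eqP->//|pq] qr; rewrite /preceq (prec_preceq pq qr) orbT.
Qed.

Lemma mem_z_list e : e \in H -> val e.2 \in z_list n a.
Proof.
move=> eH; apply/mapP; exists e.2 => //; rewrite mem_filter mem_enum andbT.
by apply/set0Pn; exists e.1; apply/imsetP; exists e; rewrite ?inE ?eH ?eqxx.
Qed.

Lemma z_list_le_top (k : nat) : k \in z_list n a -> k <= top_z n a.
Proof.
move=> kz; rewrite /top_z -nth_last -{1}(nth_index 0 kz).
have sorted_z : sorted leq (z_list n a).
  apply: (@subseq_sorted _ leq leq_trans _ [seq val k | k <- enum 'I_n]).
    exact/map_subseq/filter_subseq.
  by rewrite val_enum_ord iota_sorted.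
have := kz; rewrite -index_mem.
case: (size _) (sorted_leq_nth leq_trans leqnn 0 sorted_z) => // m mono.
by rewrite ltnS => idx_le; apply: mono; rewrite ?inE //=; lia.
Qed.

Lemma block_prec_total e e' : e.2 = e'.2 ->
  let leb := fun e e' => (e == e') || block_prec a e e' in leb e e' || leb e' e.
Proof.
case: e e' => [[p q] k] [[p' q'] k'] /= ->.
rewrite /block_prec !xpair_eqE !ord_eqE; lia.
Qed.

(** Among edges with the same z, the block ordering goes backwards along [prec]
on the y. *)
Lemma block_prec_preceq e e' : e.2 = e'.2 :> nat -> block_prec a e e' ->
  preceq e'.1.2 e.1.2.
Proof.
case: e e' => [[p q] k] [[p' q'] k'] /= kk'.
rewrite /block_prec /preceq /prec !ord_eqE kk' ltnn eqxx /=.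
case/or3P => [lt_q|/andP[/eqP-> lt_q]|/and3P[_ /eqP-> _]]; last by rewrite eqxx.
  by rewrite lt_q orbT.
by rewrite eqxx lt_q !orbT.
Qed.

Hypothesis sum_a : sumn a = n.

Lemma alpha_size : alpha a (size a) = n.
Proof. by rewrite /alpha -sum_a sumnE (big_nth 0) big_mkord. Qed.

(** The block of [j] is the least [m] such that [j] is less than
[alpha a m.+1]; such an [m] exists because the blocks fill up 0, ..., n - 1. *)
Lemma block_of_size j : block_of a j < size a.
Proof.
rewrite /block_of /first_block -[X in _ < X](size_iota 0) -has_find.
apply/hasP.
have [m jm m_min]: {m | j < alpha a m.+1 & forall m', j < alpha a m'.+1 -> m <= m'}.
  suff ex : exists m, j < alpha a m.+1.
    by have [m] := ex_minnP ex; exists m.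
  by exists (size a); rewrite alphaS alpha_size ltn_addr.
have alpha_m : alpha a m <= j.
  case: m m_min {jm} => [|m] m_min; first by rewrite /alpha big_ord0.
  by rewrite leqNgt; apply/negP => /m_min; rewrite ltnn.
exists m; last first.
  by apply/set0Pn; exists j; rewrite !inE alpha_m jm eqxx.
rewrite mem_iota add0n /= ltnNge; apply/negP => /leq_alpha.
by rewrite alpha_size leqNgt (leq_ltn_trans alpha_m).
Qed.

Lemma mem_block_of j : j \in block n a (block_of a j).
Proof.
have := block_of_size j.
rewrite {1}/block_of /first_block -[X in _ < X](size_iota 0) -has_find.
move/(nth_find 0) => /=; rewrite nth_iota ?add0n; last exact: block_of_size.
by case/set0Pn => i; rewrite in_setI in_set1 => /andP[iB /eqP ij]; rewrite ij in iB.
Qed.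

Lemma leq_block_of i j : i <= j -> block_of a i <= block_of a j.
Proof.
have := mem_block_of i; have := mem_block_of j; rewrite !inE.
move=> /andP[_ jlt] /andP[ile _] ij; rewrite leqNgt; apply/negP => /leq_alpha.
by lia.
Qed.

Lemma mem_block t j : (j \in block n a t) = (t == block_of a j).
Proof.
apply/idP/eqP => [|->]; last exact: mem_block_of.
have := mem_block_of j; rewrite !inE => /andP[jle jlt] /andP[tle tlt].
by case: (ltngtP t (block_of a j)) => // /leq_alpha; lia.
Qed.

(** Blocks are consecutive intervals, so that the first block met by a set is that
of its least element. *)
Lemma first_block_min (A : {set 'I_n}) i : i \in A ->
  {in A, forall j, i <= j} -> first_block a A = block_of a i.
Proof.
move=> iA i_min; apply/eqP; rewrite eqn_leq; apply/andP; split.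
  rewrite leqNgt; apply/negP => /(before_find 0).
  rewrite nth_iota ?block_of_size // add0n /= => /negbFE/eqP/setP/(_ i).
  by rewrite in_setI mem_block_of iA inE.
have hasA : has (fun t => block n a t :&: A != set0) (iota 0 (size a)).
  apply/hasP; exists (block_of a i); first by rewrite mem_iota block_of_size.
  by apply/set0Pn; exists i; rewrite in_setI mem_block_of.
have := hasA => /(nth_find 0) /=.
have := hasA; rewrite has_find size_iota => lt_size; rewrite nth_iota // add0n.
case/set0Pn => j; rewrite in_setI mem_block => /andP[/eqP def_j jA].
rewrite /first_block def_j; exact/leq_block_of/i_min.
Qed.

(** The block of [i] meets the triple in [i] alone exactly when [j], hence also
[k], is in a later block. *)
Lemma matchingE i j k : i < j -> j < k ->
  matching a i j k = if prec i j then (i, j, k) else (j, i, k).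
Proof.
move=> ij jk; have ble := leq_block_of (ltnW ij).
have bjk := leq_block_of (ltnW jk).
rewrite /matching (@first_block_min _ i); first last.
- by move=> l; rewrite !inE -orbA => /or3P[] /eqP->; lia.
- by rewrite !inE eqxx.
have -> : prec i j = (block_of a i == block_of a j) by rewrite /prec; lia.
case: (block_of a i =P block_of a j) => bij.
  rewrite ifN // gtn_eqF //.
  have <-: #|[set i; j]| = 2 by rewrite cards2 -val_eqE /= ltn_eqF.
  apply/subset_leq_card/subsetP => l.
  rewrite in_setI mem_block !inE.
  by case/orP => /eqP->; rewrite ?bij !eqxx ?orbT.
rewrite ifT //; apply/cards1P; exists i; apply/setP => l.
rewrite in_setI mem_block !inE; have [->|li] := eqVneq l i; first by rewrite !eqxx.
have [->|lj] := eqVneq l j; first by rewrite orbT; lia.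
have [->|//] := eqVneq l k; lia.
Qed.

(** The two cases in the definition of the matching field merge into one order
condition. This symmetric description is what makes the exchanges of variables
possible. *)
Lemma HedgesE p q k :
  ((p, q, k) \in H) = [&& p < k, q < k & prec p q].
Proof.
apply/imsetP/and3P => [[[[i j] l]] /=|[pk qk pq]].
  rewrite inE /= => /andP[ij jl]; rewrite matchingE //.
  case: ifPn => pr [-> -> ->]; split=> //; try lia.
  by have := leq_block_of (ltnW ij); move: pr; rewrite /prec; lia.
have [pq_lt|qp] := ltnP p q.
  by exists (p, q, k); rewrite ?inE /= ?pq_lt // matchingE // pq.
have qp_lt : q < p.
  by rewrite ltn_neqAle qp andbT; apply: contraTneq pq => /val_inj->; rewrite /prec; lia.
exists (q, p, k); rewrite ?inE /= ?qp_lt // matchingE // ifN //.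
by move: pq; rewrite /prec; lia.
Qed.

(** Increasing the index of z in an edge gives an edge. *)
Lemma edge_top e : e \in H ->
  exists2 k : 'I_n, val k = top_z n a & (e.1, k) \in H.
Proof.
move=> eH; have /z_list_le_top := mem_z_list eH.
have : top_z n a \in z_list n a.
  by rewrite /top_z; case: (z_list n a) (mem_z_list eH) => //= x s _; apply: mem_last.
case/mapP => k _ def_k; rewrite def_k => le_k; exists k => //.
move: eH; case: e le_k => [[p q] l] /= le_k; rewrite !HedgesE.
by case/and3P => pl ql ->; rewrite (leq_trans pl) ?(leq_trans ql).
Qed.

Lemma mem_y_list e : e \in H -> val e.1.2 \in y_list n a.
Proof.
move=> /edge_top[k def_k ekH]; rewrite mem_undup.
apply/mapP; exists (e.1, k) => //; rewrite mem_sort mem_enum inE ekH /=.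
by rewrite -def_k.
Qed.

(** In the top z-layer all the edges are sorted from the last y to the first one
for [prec]; an arbitrary edge has the same y as an edge of this layer. *)
Lemma y_list_head e : e \in H ->
  exists2 e1, e1 \in H & [/\ val e1.2 = top_z n a, val e1.1.2 = head 0 (y_list n a)
    & forall e', e' \in H -> preceq e'.1.2 e1.1.2].
Proof.
move=> eH; pose leb e e' := (e == e') || block_prec a e e'.
pose tops := enum [set e in H | e.2 == top_z n a :> nat].
pose ys := [seq e.1.2 | e <- sort leb tops].
have topsP e' : e' \in sort leb tops -> e' \in H /\ val e'.2 = top_z n a.
  by rewrite mem_sort mem_enum inE => /andP[-> /eqP].
have def_y : y_list n a = [seq val q | q <- undup ys].
  by rewrite /y_list -(undup_map_inj val_inj) -map_comp.
(* [undup] keeps the last occurrences, but a subsequence of a sorted sequence is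
   sorted, which suffices to find the head. *)
have sorted_ys : sorted (fun q p => preceq p q) (undup ys).
  apply: (subseq_sorted _ (undup_subseq _)) => [q p r pq qr|].
    exact: preceq_trans qr pq.
  have sorted_e : sorted leb (sort leb tops).
    apply: (@sort_sorted_in _ (mem tops)) => [e1 e2|].
      rewrite !mem_enum !inE => /andP[_ /eqP t1] /andP[_ /eqP t2].
      by apply: block_prec_total; apply: val_inj; rewrite /= t1 t2.
    by apply/allP.
  apply: (@homo_sorted_in _ _ (mem (sort leb tops)) _ leb) sorted_e; last by apply/allP.
  move=> e1 e2 /topsP[_ t1] /topsP[_ t2] /orP[/eqP->|]; first by rewrite /preceq eqxx.
  exact: block_prec_preceq (etrans t1 (esym t2)).
have mem_ys e' : e' \in H -> e'.1.2 \in undup ys.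
  move=> /edge_top[k def_k ekH]; rewrite mem_undup; apply/mapP.
  by exists (e'.1, k) => //; rewrite mem_sort mem_enum inE ekH -def_k /=.
case def_u: (undup ys) (mem_ys e eH) => [//|q qs] _.
have : q \in ys by rewrite -mem_undup def_u mem_head.
case/mapP => e1 /topsP[e1H top1] def_q; exists e1 => //; split=> //.
  by rewrite def_y def_u /= def_q.
move=> e' /mem_ys; rewrite def_u -def_q inE => /orP[/eqP->|e'q].
  by rewrite /preceq eqxx.
move: sorted_ys; rewrite def_u /= => /order_path_min/allP; apply=> //.
by move=> p r t rp pt; apply: preceq_trans pt rp.
Qed.

(** The x of an edge precedes its y, hence precedes the last y of the top layer,
with which it forms an edge of this layer. *)
Lemma mem_x_list e : e \in H -> val e.1.1 \in x_list n a.
Proof.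
move=> eH; have [e1 e1H [top1 head1 max1]] := y_list_head eH.
apply/mapP; exists e.1.1 => //; rewrite mem_filter mem_enum andbT.
have e1'H : (e.1.1, e1.1.2, e1.2) \in H.
  have := max1 e eH; have [k def_k] := edge_top eH.
  have -> : k = e1.2 by apply: val_inj; rewrite def_k top1.
  case: e e1 {eH top1 head1 max1 def_k} e1H => [[p q] l] [[p1 q1] l1] /=.
  rewrite !HedgesE => /and3P[_ -> _] /and3P[-> _ pq] /(prec_preceq pq)->.
  by [].
apply/imsetP; exists (e.1.1, e1.1.2) => //; rewrite inE head1 eqxx andbT.
by apply/imsetP; exists (e.1.1, e1.1.2, e1.2); rewrite // inE e1'H /= top1 eqxx.
Qed.

End MatchingEdges.

(** * The complex of a matching field *)

Section MatchingComplex.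
Variables (n : nat) (a : seq nat).
Hypothesis sum_a : sumn a = n.
Local Notation H := (Hedges n a).
Local Notation G := (Gedges n a).
Local Notation X := (X_Ga n a).
Local Notation lab := (@X_Ga_label n a).
Local Notation tuple3 := {ffun 'I_3 -> 'I_(Gsize n a)}.
Implicit Types (e : triple n) (x y : tuple3) (s t : X) (m : 'X_{1..n + n + n}).

Let iz : 'I_3 := @Ordinal 3 0 isT.
Let iy : 'I_3 := @Ordinal 3 1 isT.
Let ix : 'I_3 := @Ordinal 3 2 isT.

Lemma ord3P (P : 'I_3 -> Prop) : P iz -> P iy -> P ix -> forall i, P i.
Proof.
move=> Pz Py Px [[|[|[|k]]] lt_k] //.
- by rewrite (_ : Ordinal _ = iz) //; apply: val_inj.
- by rewrite (_ : Ordinal _ = iy) //; apply: val_inj.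
- by rewrite (_ : Ordinal _ = ix) //; apply: val_inj.
Qed.

(** The values of f on the z come before those on the y, which come before those
on the x. *)
Lemma f_bounds e : e \in H ->
  [/\ (fz n a e.2 < fy n a e.1.2)%N, (fy n a e.1.2 < fx n a e.1.1)%N
    & (fx n a e.1.1 < Gsize n a)%N].
Proof.
move=> eH; have := mem_z_list eH; have := mem_y_list sum_a eH.
have := mem_x_list sum_a eH; rewrite -!index_mem /fz /fy /fx /Gsize /=; split; lia.
Qed.

Lemma fz_inj e e' : e \in H -> e' \in H ->
  fz n a e.2 = fz n a e'.2 -> e.2 = e'.2.
Proof.
move=> /mem_z_list z0 /mem_z_list z' fz_eq; apply: val_inj.
apply: (index_inj 0%N z0 z'); move: fz_eq; rewrite /fz.
by have := z0; have := z'; rewrite -!index_mem /=; lia.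
Qed.

Lemma fy_inj e e' : e \in H -> e' \in H ->
  fy n a e.1.2 = fy n a e'.1.2 -> e.1.2 = e'.1.2.
Proof.
move=> /(mem_y_list sum_a) y0 /(mem_y_list sum_a) y' /addnI fy_eq.
exact/val_inj/(index_inj 0%N y0 y').
Qed.

Lemma fx_inj e e' : e \in H -> e' \in H ->
  fx n a e.1.1 = fx n a e'.1.1 -> e.1.1 = e'.1.1.
Proof.
move=> /(mem_x_list sum_a) x0 /(mem_x_list sum_a) x' /addnI fx_eq.
exact/val_inj/(index_inj 0%N x0 x').
Qed.

(** [x] is the increasing enumeration of the edge of G_a corresponding to [e]. *)
Definition at_edge e x : bool :=
  [&& val (x iz) == fz n a e.2, val (x iy) == fy n a e.1.2
    & val (x ix) == fx n a e.1.1].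

Lemma at_edge_ex e : e \in H -> exists x, at_edge e x.
Proof.
move=> eH; have [zy yx ltx] := f_bounds eH.
have lty := ltn_trans yx ltx; have ltz := ltn_trans zy lty.
exists [ffun i : 'I_3 => if i == iz then Ordinal ltz
   else if i == iy then Ordinal lty else Ordinal ltx].
by rewrite /at_edge !ffunE /= !eqxx.
Qed.

Lemma at_edge_inj e e' x : e \in H -> e' \in H ->
  at_edge e x -> at_edge e' x -> e = e'.
Proof.
move=> eH e'H /and3P[/eqP z /eqP y /eqP w] /and3P[/eqP z' /eqP y' /eqP w'].
have ez : e.2 = e'.2 by apply: fz_inj; rewrite // -z.
have ey : e.1.2 = e'.1.2 by apply: fy_inj; rewrite // -y.
have ew : e.1.1 = e'.1.1 by apply: fx_inj; rewrite // -w.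
by rewrite [e]surjective_pairing [e.1]surjective_pairing ez ey ew -!surjective_pairing.
Qed.

Lemma at_edge_fun e x y : at_edge e x -> at_edge e y -> x = y.
Proof.
move=> /and3P[/eqP z /eqP y' /eqP w] /and3P[/eqP z' /eqP y'' /eqP w'].
apply/ffunP; apply: ord3P; apply: val_inj.
- exact: etrans z (esym z').
- exact: etrans y' (esym y'').
- exact: etrans w (esym w').
Qed.

Lemma image_tuple3 x : [set x i | i : 'I_3] = [set x iz; x iy; x ix].
Proof.
apply/setP => v; rewrite !inE -orbA; apply/imsetP/or3P.
  by case=> i _ ->; elim/ord3P: i; [apply: Or31|apply: Or32|apply: Or33].
by case=> /eqP->; [exists iz|exists iy|exists ix].
Qed.

Lemma Gedge_at e x : at_edge e x -> Gedge a e = [set x i | i : 'I_3].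
Proof.
case/and3P => /eqP z /eqP y /eqP w; rewrite image_tuple3.
by apply/setP => v; rewrite !inE -z -y -w -orbA !val_eqE.
Qed.

(** An increasing triple is determined by its set of values, and the images under f
of the z, the y and the x of an edge increase. *)
Lemma at_edge_image e x : e \in H ->
  [forall i : 'I_3, forall j : 'I_3, (i < j)%N ==> (x i < x j)%O] ->
  [set x i | i : 'I_3] = Gedge a e -> at_edge e x.
Proof.
move=> eH /forallP incr im_x; have [fzy fyx _] := f_bounds eH.
have incr_at (i j : 'I_3) : (i < j)%N -> (x i < x j)%N.
  by have /forallP/(_ j)/implyP := incr i => + ij => /(_ ij); rewrite ltEord.
have zy := incr_at iz iy isT; have yx := incr_at iy ix isT.
have in_e i : val (x i) \in [:: fz n a e.2; fy n a e.1.2; fx n a e.1.1].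
  have : x i \in Gedge a e by rewrite -im_x imset_f.
  by rewrite inE.
have := in_e iz; have := in_e iy; have := in_e ix.
rewrite /at_edge !inE; move: zy yx fzy fyx => /=; lia.
Qed.

Lemma edge_tupleE x : edge_tuple G x = [exists e in H, at_edge e x].
Proof.
apply/andP/exists_inP => [[incr /imsetP[e eH im_x]]|[e eH ex]].
  by exists e => //; apply: at_edge_image.
split; last by apply/imsetP; exists e; rewrite // (Gedge_at ex).
have [fzy fyx _] := f_bounds eH; have /and3P[/eqP z /eqP y /eqP w] := ex.
apply/forallP => i; apply/forallP => j; apply/implyP; rewrite ltEord.
move: j; elim/ord3P: i => j; elim/ord3P: j => //= _; rewrite ?z ?y ?w; lia.
Qed.

Lemma vertexP s : cdim s = 0%N -> exists e x,
  [/\ e \in H, at_edge e x, val s = [ffun i => [set x i]] & lab s = mon e].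
Proof.
move=> s0; have pr_s := proper_cell s.
have pick_s i : {v | val s i == [set v]}.
  by apply/sigW; have /eqP/cards1P[v ->] := card_vertex i pr_s s0; exists v.
pose x : tuple3 := [ffun i => sval (pick_s i)].
have sx : val s = [ffun i => [set x i]].
  by apply/ffunP => i; rewrite !ffunE; apply/eqP; case: (pick_s i).
clearbody x; have : edge_tuple G x.
  have /box_inP[_] : box_in (edge_tuple G) (val s) := valP s.
  by apply; apply/forallP => i; rewrite sx ffunE inE.
move=> Qx; have := Qx; rewrite edge_tupleE => /exists_inP[e eH ex].
exists e, x; split=> //.
have supp_s : XG_support s = Gedge a e.
  rewrite (Gedge_at ex) /XG_support sx; apply/setP => v.
  apply/bigcupP/imsetP => [[i _]|[i _ ->]]; first by rewrite ffunE inE => /eqP->; exists i.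
  by exists i => //; rewrite ffunE set11.
rewrite /X_Ga_label; case: pickP => [e' /andP[e'H /eqP e'e]|/(_ e)]; last first.
  by rewrite eH supp_s eqxx.
congr (mon _); apply: (at_edge_inj e'H eH _ ex); apply: at_edge_image.
- exact: e'H.
- by move: Qx => /andP[].
- by rewrite e'e supp_s (Gedge_at ex).
Qed.

Lemma vertex_ex e x : e \in H -> at_edge e x ->
  exists s : X, [/\ cdim s = 0%N, val s = [ffun i => [set x i]] & lab s = mon e].
Proof.
move=> eH ex; have sE : is_cell G [ffun i => [set x i]].
  rewrite is_cellE; apply/box_inP; split.
    by apply/forallP => i; rewrite ffunE; apply/set0Pn; exists (x i); rewrite inE.
  move=> y /forallP yx; rewrite edge_tupleE; apply/exists_inP; exists e => //.
  suff -> : y = x by [].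
  by apply/ffunP => i; have := yx i; rewrite ffunE inE => /eqP.
pose s : X := Sub [ffun i => [set x i]] sE; exists s.
have s0 : cdim s = 0%N by apply: big1 => i _; rewrite ffunE cards1.
split=> //; have [e' [y [e'H e'y def_s ->]]] := vertexP s0.
congr (mon _); apply: at_edge_inj (e'y) _ => //.
suff -> : y = x by [].
apply/ffunP => i; have /ffunP/(_ i) := def_s.
by rewrite !ffunE => /setP/(_ (y i)); rewrite !inE eqxx => /eqP.
Qed.

(** The positions of x_p, y_q and z_k among the 3n variables. *)
Let vx (p : 'I_n) : 'I_(n + n + n) := lshift n (lshift n p).
Let vy (q : 'I_n) : 'I_(n + n + n) := lshift n (rshift n q).
Let vz (k : 'I_n) : 'I_(n + n + n) := rshift (n + n) k.

Lemma monE e v : mon e v = ((vx e.1.1 == v) + (vy e.1.2 == v) + (vz e.2 == v))%N.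
Proof. by rewrite !mnmDE !mnm1E. Qed.

(** The generators are squarefree. *)
Lemma mon_le e m :
  (mon e <= m)%MM = [&& m (vx e.1.1) != 0%N, m (vy e.1.2) != 0%N & m (vz e.2) != 0%N].
Proof.
apply/mnm_lepP/and3P => [le_m|[mx my mz] v].
  by split; rewrite -lt0n; apply: leq_trans (le_m _); rewrite monE eqxx; lia.
have yx : (vy e.1.2 == vx e.1.1) = false by rewrite /vx /vy !eq_shift.
have zx : (vz e.2 == vx e.1.1) = false by rewrite /vx /vz !eq_shift.
have zy : (vz e.2 == vy e.1.2) = false by rewrite /vy /vz !eq_shift.
rewrite monE; have [<-|_] := eqVneq (vx e.1.1) v; first by rewrite yx zx; lia.
have [<-|_] := eqVneq (vy e.1.2) v; first by rewrite zy; lia.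
by have [<-|_] := eqVneq (vz e.2) v; lia.
Qed.

Definition below_tuple m x : bool :=
  [exists e in H, at_edge e x && (mon e <= m)%MM].

(** The label of a cell is the lcm of the labels of its vertices, and its vertices
are the points of the box. *)
Lemma clab_below s m : (clab lab s <= m)%MM = box_in (below_tuple m) (val s).
Proof.
apply/clab_leP/box_inP => [le_m|[_ sm] v /eqP v0 /forallP vs].
  split=> [|x /forallP sx]; first exact: proper_cell.
  have : edge_tuple G x.
    have /box_inP[_] : box_in (edge_tuple G) (val s) := valP s.
    by apply; apply/forallP.
  rewrite edge_tupleE => /exists_inP[e eH ex].
  have [v [v0 def_v lab_v]] := vertex_ex eH ex.
  apply/exists_inP; exists e; rewrite // ex -lab_v /=; apply: le_m.
    by rewrite v0.
  by apply/forallP => i; rewrite def_v ffunE sub1set.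
have [e [x [eH ex def_v ->]]] := vertexP v0.
have /sm/exists_inP[e' e'H /andP[e'x]] : in_box (val s) x.
  by apply/forallP => i; have := vs i; rewrite def_v ffunE sub1set.
by rewrite (at_edge_inj e'H eH e'x ex).
Qed.

Lemma preceq_total (p q : 'I_n) : preceq a p q || preceq a q p.
Proof.
by rewrite /preceq; have /or3P[|->|->] := prec_total a p q; rewrite ?orbT // => ->.
Qed.

(** Three successive cones reduce the complex to a point. The three stages are the
predicates [P], [P1] and [Q2]: edges below [m], those with the largest z, and
those which have also the last y. *)
Lemma acyclic_below_tuple (K : fieldType) m : acyclic_in K (below_tuple m).
Proof.
pose P e := (e \in H) && (mon e <= m)%MM.
have belowP x : reflect (exists2 e, P e & at_edge e x) (below_tuple m x).
  apply: (iffP exists_inP) => [[e eH /andP[ex em]]|[e /andP[eH em] ex]].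
    by exists e; rewrite // /P eH.
  by exists e; rewrite ?ex.
(* If no generator divides [m], there is no cell to consider. *)
have [e /= Pe|noP] := pickP P; last first.
  by apply: acyclic_point => x y /belowP[e]; rewrite noP.
case: (arg_maxnP (fun e => val e.2) Pe) => e0 {e Pe} Pe0 max0.
have [e0H _] := andP Pe0; have [x0 e0x0] := at_edge_ex e0H.
apply: (@acyclic_cone _ _ _ _ _ iz (x0 iz)) => [x /belowP[e Pe ex]|].
  apply/belowP; exists (e.1, e0.2).
    move: Pe Pe0 (max0 e Pe); rewrite /P !mon_le /=.
    case: e {ex} => [[p q] k]; case: e0 {max0 e0H e0x0} => [[p0 q0] k0] /=.
    rewrite !HedgesE // => /andP[/and3P[pk qk ->] /and3P[-> -> _]].
    move=> /andP[_ /and3P[_ _ ->]] kk0.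
    by rewrite (leq_trans pk) ?(leq_trans qk).
  move: ex e0x0 => /and3P[_ ey ew] /and3P[ez _ _].
  by rewrite /at_edge !ffunE /= ez ey ew.
pose P1 e := P e && (e.2 == e0.2).
have below1P x : reflect (exists2 e, P1 e & at_edge e x)
    (below_tuple m x && (x iz == x0 iz)).
  apply: (iffP andP) => [[/belowP[e Pe ex] /eqP xz]|[e /andP[Pe /eqP ez] ex]].
    exists e => //; rewrite /P1 Pe; apply/eqP; have [eH _] := andP Pe.
    apply: fz_inj => //; move: ex e0x0 => /and3P[/eqP<- _ _] /and3P[/eqP<- _ _].
    by rewrite xz.
  split; first by apply/belowP; exists e.
  move: ex e0x0 => /and3P[/eqP xz _ _] /and3P[/eqP x0z _ _].
  by apply/eqP/val_inj; rewrite /= xz x0z ez.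
have P1e0 : P1 e0 by rewrite /P1 Pe0 eqxx.
case: (@extremumP _ _ (fun q p => preceq a p q) e0 P1 (fun e => e.1.2)) => //.
- by move=> q; rewrite /preceq eqxx.
- by move=> q p r qp rq; apply: preceq_trans rq qp.
- by move=> p q; apply: preceq_total.
move=> e1 P1e1 max1; have /andP[Pe1 /eqP e1z] := P1e1.
have [e1H _] := andP Pe1; have [x1 e1x1] := at_edge_ex e1H.
apply: (@acyclic_cone _ _ _ _ _ iy (x1 iy)) => [x /below1P[e P1e ex]|].
  apply/below1P; exists (e.1.1, e1.1.2, e0.2).
    move: P1e P1e1 (max1 e P1e); rewrite /P1 /P !mon_le /= eqxx.
    case: e {ex} => [[p q] k].
    case: e1 {max1 e1H e1x1 Pe1 e1z} => [[p1 q1] k1] /=.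
    rewrite !HedgesE // => /andP[/andP[/and3P[pk qk pq] /and3P[-> _ mz]] /eqP <-].
    move=> /andP[/andP[/and3P[pk1 qk1 pq1] /and3P[_ -> _]] /eqP k1k] qq1.
    by rewrite pk -k1k qk1 k1k mz (prec_preceq pq qq1).
  have /andP[_ /eqP def_z] := P1e.
  move: ex e1x1 => /and3P[ez ey ew] /and3P[_ e1y _].
  by rewrite /at_edge !ffunE /= -def_z ez e1y ew.
set Q2 := (fun x => _ && (x iy == x1 iy)).
have Q2x1 : Q2 x1 by rewrite /Q2 eqxx andbT; apply/below1P; exists e1.
have Q2z x y : Q2 x -> Q2 y -> x iz = y iz /\ x iy = y iy.
  by move=> /andP[/andP[_ /eqP->] /eqP->] /andP[/andP[_ /eqP->] /eqP->].
apply: (@acyclic_cone _ _ _ _ _ ix (x1 ix)) => [x Q2x|].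
  suff -> : update x ix (x1 ix) = x1 by [].
  have [xz xy] := Q2z _ _ Q2x Q2x1.
  by apply/ffunP; apply: ord3P; rewrite ffunE.
apply: acyclic_point => x y /andP[Q2x /eqP xx] /andP[Q2y /eqP yx].
have [xz xy] := Q2z _ _ Q2x Q2y.
by apply/ffunP; apply: ord3P; rewrite ?xx ?yx.
Qed.

(** All the generators have degree 3. *)
Lemma mon_le_inj e e' : (mon e <= mon e')%MM -> e = e'.
Proof.
rewrite mon_le !monE /vx /vy /vz !eq_shift => /and3P[].
case: e e' => [[p q] k] [[p' q'] k'] /=.
by have [->|] := eqVneq p' p; have [->|] := eqVneq q' q; have [->|] := eqVneq k' k.
Qed.

Lemma vertexE s x y : val s = [ffun i => [set x i]] -> in_box (val s) y -> y = x.
Proof.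
move=> def_s /forallP sy; apply/ffunP => i.
by have := sy i; rewrite def_s ffunE inE => /eqP.
Qed.

(** A vertex has no other vertex as a face. *)
Lemma clab_vertex s : cdim s = 0%N -> clab lab s = lab s.
Proof.
move=> s0; have [e [x [eH ex def_s lab_s]]] := vertexP s0.
have le_s : (clab lab s <= lab s)%MM.
  apply/clab_leP => v /eqP v0 /forallP vs.
  have [e' [y [e'H e'y def_v ->]]] := vertexP v0.
  have yx : y = x.
    apply: (vertexE def_s); apply/forallP => i.
    by have := vs i; rewrite def_v ffunE sub1set.
  by rewrite yx in e'y; rewrite (at_edge_inj e'H eH e'y ex) lab_s lepm_refl.
have ge_s : (lab s <= clab lab s)%MM.
  have /clab_leP := lepm_refl (clab lab s); apply; first by rewrite s0.
  by apply/forallP => i.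
apply/mnmP => k; apply/eqP.
by rewrite eqn_leq (mnm_lepP le_s) (mnm_lepP ge_s).
Qed.

(** The variable of the edge [e] that f maps to the [i]-th entry of its
enumeration. *)
Let var e (i : 'I_3) :=
  if i == iz then vz e.2 else if i == iy then vy e.1.2 else vx e.1.1.

Lemma mon_var e i : mon e (var e i) != 0%N.
Proof. by move: i; apply: ord3P; rewrite /var /= monE eqxx; lia. Qed.

Lemma mon_var_at e e' x y i : at_edge e x -> at_edge e' y ->
  mon e' (var e i) != 0%N -> y i = x i.
Proof.
move=> /and3P[/eqP xz /eqP xy /eqP xx] /and3P[/eqP yz /eqP yy /eqP yx].
move: i; apply: ord3P; rewrite /var /= monE /vx /vy /vz !eq_shift.
- by case: (e'.2 =P e.2) => // ez _; apply: val_inj; rewrite /= yz xz ez.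
- by case: (e'.1.2 =P e.1.2) => // ey _; apply: val_inj; rewrite /= yy xy ey.
- by case: (e'.1.1 =P e.1.1) => // ew _; apply: val_inj; rewrite /= yx xx ew.
Qed.

(** Let [v] be the vertex deleted from the [i]-th factor of [s] to get [t]. The
variable of [v] divides the label of some vertex of [s], but no vertex of [t]
has [v] as [i]-th coordinate. *)
Lemma clab_inc_nle s t : cinc s t != 0 -> ~~ (clab lab s <= clab lab t)%MM.
Proof.
case/XG_inc_neq0 => -[i v] sv def_t; rewrite clab_below.
apply/negP => /box_inP[_ s_below].
have pick_t j : {u | u \in val t j}.
  by apply/sigW/set0Pn; have /forallP := proper_cell t.
pose x : tuple3 := [ffun j => if j == i then v else sval (pick_t j)].
have xi : x i = v by rewrite ffunE eqxx.
have /s_below/exists_inP[e eH /andP[ex /mnm_lepP/(_ (var e i)) le_t]] : in_box (val s) x.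
  apply/forallP => j; rewrite ffunE; case: eqP => [->//|_].
  case: (pick_t j) => u /=; rewrite def_t => tu.
  have : on_box (del_point (val s) (i, v)) (j, u) by [].
  by rewrite on_del_point => /andP[].
have : clab lab t (var e i) != 0%N.
  by have := mon_var e i; lia.
rewrite clabE; apply/negP; rewrite negbK -leqn0; apply/bigmax_leqP => w.
move=> /andP[/eqP w0 /forallP wt]; rewrite leqn0.
have [e' [y [e'H e'y def_w ->]]] := vertexP w0.
apply: contraT => /(mon_var_at ex e'y) yx; have := wt i.
rewrite def_w ffunE sub1set yx xi def_t.
by rewrite -[_ \in _]/(on_box (del_point (val s) (i, v)) (i, v)) on_del_point eqxx.
Qed.

Lemma XGa_supports_resolution (K : fieldType) :
  supports_minimal_cellular_resolution lab (@matching_ideal n a K).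
Proof.
pose P m := exists2 e, e \in H & m = mon e.
have genP m : P m <-> exists2 v, v \in cells X 0 & lab v = m.
  split=> [[e eH ->]|[v]].
    have [x ex] := at_edge_ex eH; have [v [v0 _ lab_v]] := vertex_ex eH ex.
    by exists v; rewrite // inE v0.
  by rewrite inE => /eqP/vertexP[e [_ [eH _ _ ->]]] <-; exists e.
split.
- move=> s t; rewrite !inE => /eqP/vertexP[e [x [eH ex def_s ->]]].
  move=> /eqP/vertexP[e' [y [e'H e'y def_t ->]]] eq_mon.
  have ee' : e = e' by apply: mon_le_inj; rewrite eq_mon lepm_refl.
  rewrite -ee' in e'y; apply: val_inj.
  by rewrite /= def_s def_t (at_edge_fun ex e'y).
- move=> m; rewrite -genP; split=> [[/mem_monomial_ideal[_ [e eH ->] le_m] min_m]|].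
    exists e => //; symmetry; apply: min_m => //; apply/mem_monomial_ideal.
    by exists (mon e); [exists e|exact: lepm_refl].
  move=> [e eH ->]; split.
    by apply/mem_monomial_ideal; exists (mon e); [exists e|exact: lepm_refl].
  move=> m' le_m /mem_monomial_ideal[_ [e' e'H ->] le_m'].
  have ee' := mon_le_inj (lepm_trans le_m' le_m); rewrite ee' in le_m'.
  by apply/mnmP => k; apply/eqP; rewrite eqn_leq (mnm_lepP le_m) (mnm_lepP le_m').
- apply: free_resolution_of_acyclic.
  + exact: XG_inc_dim.
  + move=> s t nz; rewrite clab_below.
    have [p sp def_t] := XG_inc_neq0 nz.
    have : box_in (below_tuple (clab lab s)) (val s) by rewrite -clab_below lepm_refl.
    apply: box_in_sub; last exact: proper_cell.
    by move=> q; rewrite def_t on_del_point => /andP[].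
  + exact: XG_inc_inc.
  + by move=> s _; apply: XG_inc_aug.
  + move=> m; apply: (XG_acyclic_below (Q := below_tuple m)).
    * by move=> s; apply: clab_below.
    * move=> x /exists_inP[e eH /andP[ex _]]; rewrite edge_tupleE.
      by apply/exists_inP; exists e.
    * exact: acyclic_below_tuple.
  + move=> m; rewrite -/(P m) genP; split=> -[v v0 <-]; exists v => //.
      by rewrite clab_vertex //; move: v0; rewrite inE => /eqP.
    by rewrite clab_vertex //; move: v0; rewrite inE => /eqP.
- move=> i p q; have -> : cell_diff K lab i p q =
      hdiff K lab (enum_val p) (enum_val q) by rewrite mxE.
  rewrite /hdiff; have [->|/clab_inc_nle nle] := eqVneq (cinc (enum_val p) (enum_val q)) 0.
    by rewrite mul0r mcoeff0.
  rewrite mulrzl raddfMz /= mcoeffX; case: eqP => [sub0|]; last by rewrite mul0rz.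
  case/negP: nle; apply/mnm_lepP => k.
  by have /mnmP/(_ k) := sub0; rewrite mnmBE mnm0E => /eqP.
Qed.

End MatchingComplex.

Theorem corollary2 (K : fieldType) (n : nat) (a : seq nat)
    (hn : (3 <= n)%N) (ha : all (fun b : nat => (0 < b)%N) a)
    (hsum : sumn a = n) :
  supports_minimal_cellular_resolution
    (@X_Ga_label n a) (@matching_ideal n a K).
Proof. exact: XGa_supports_resolution. Qed.
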